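(* Let $n\in\mathbb{N}$ and let $\kappa,\lambda\in\mathcal{P}_n$ with $\kappa\geq\lambda$ in lexicographic order. Then the zonal polynomial coefficient satisfies $c_{\kappa,\lambda}=0$ if and only if there exists $p\in\mathbb{N}$ such that $$\sum_{i=1}^{p}(\kappa_i-\lambda_i)<0,$$ where the partitions $\kappa=(\kappa_1,\kappa_2,\ldots)$ and $\lambda=(\lambda_1,\lambda_2,\ldots)$ are filled up with zeros as necessary.
   Context: Partitions: $\mathcal{P}_n$ is the set of integer partitions of $n$, i.e. tuples $\lambda=(\lambda_1,\ldots,\lambda_k)$ of integers with $\lambda_1\ge\cdots\ge\lambda_k\ge 1$ and $\lambda_1+\cdots+\lambda_k=n$. They are ordered lexicographically: $\kappa>\lambda$ iff for some $l$ one has $\kappa_1=\lambda_1,\ldots,\kappa_{l-1}=\lambda_{l-1}$ and $\kappa_l>\lambda_l$. Put $\rho_\lambda:=\sum_{i=1}^{k}\lambda_i(\lambda_i-i)$. Monomial symmetric functions: for $\lambda\in\mathcal{P}_n$ and variables $y_1,\ldots,y_q$, $M_\lambda(y_1,\ldots,y_q)$ is the sum of all distinct monomials obtained from $y_1^{\lambda_1}\cdots y_k^{\lambda_k}$ by permuting the variables (and $M_\lambda=0$ if $q<k$). Zonal polynomials and their coefficients: take $q\geq n$ variables $y_1,\dots,y_q$ (the coefficients do not depend on $q$). The zonal polynomials $\mathcal{C}_\kappa$, $\kappa\in\mathcal{P}_n$, are the symmetric homogeneous polynomials of degree $n$ of the form $\mathcal{C}_\kappa=\sum_{\lambda\le\kappa}c_{\kappa,\lambda}M_\lambda$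 (with $c_{\kappa,\lambda}=0$ for $\lambda<\kappa$ with $\rho_\kappa\le\rho_\lambda$) that are eigenfunctions $$\Delta_Y\,\mathcal{C}_\kappa=(\rho_\kappa+(q-1)n)\,\mathcal{C}_\kappa,\qquad \Delta_Y=\sum_{i=1}^{q}\Big(y_i^2\frac{\partial^2}{\partial y_i^2}+\sum_{j\ne i}\frac{y_i^2}{y_i-y_j}\frac{\partial}{\partial y_i}\Big),$$ normalized by $\sum_{\kappa\in\mathcal{P}_n}\mathcal{C}_\kappa=(y_1+\cdots+y_q)^n$. The numbers $c_{\kappa,\lambda}$ are the zonal polynomial coefficients (with $c_{\kappa,\lambda}=0$ for $\lambda>\kappa$). Equivalently, the $c_{\kappa,\lambda}$ are determined recursively as follows. For $\lambda<\kappa$ with $\rho_\kappa>\rho_\lambda$, $$c_{\kappa,\lambda}=\sum_{(r,s,t)}\frac{(\lambda_r+t)-(\lambda_s-t)}{\rho_\kappa-\rho_\lambda}\,c_{\kappa,\mu},$$ the sum being over all $r<s$ and $1\le t\le\lambda_s$ such that the partition $\mu$, obtained from $\lambda$ by replacing $\lambda_r$ by $\lambda_r+t$ and $\lambda_s$ by $\lambda_s-t$ and sorting in descending order (dropping zeros), satisfies $\lambda<\mu\le\kappa$. For $\lambda<\kappa$ with $\rho_\kappa\le\rho_\lambda$, $c_{\kappa,\lambda}=0$. The diagonal entries are determined by $\sum_{\kappa\ge\lambda}c_{\kappa,\lambda}=\frac{n!}{\lambda_1!\cdots\lambda_k!}$ for every $\lambda\in\mathcal{P}_n$; in particular $c_{(n),(n)}=1$.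 *)

(* Defs.v *)
From HB Require Import structures.
From mathcomp Require Import all_boot all_order all_fingroup all_algebra.
From mathcomp.multinomials Require Import mpoly.

Set Implicit Arguments.
Unset Strict Implicit.
Unset Printing Implicit Defensive.

Import Order.TTheory GRing.Theory Num.Theory.
Import Order.DefaultSeqLexiOrder.
Local Open Scope ring_scope.

Definition is_partition (n : nat) (s : seq nat) : bool :=
  [&& sorted geq s, 0%N \notin s & sumn s == n].

(* A partition of n has at most n parts, each at most n: bounding the length
   and the entries loses nothing (see intpartnP) and makes the type finite. *)
Definition intpartn (n : nat) : finType :=
  {s : n.-bseq 'I_n.+1 | is_partition n [seq val i | i <- s]}.

Definition parts n (lam : intpartn n) : seq nat := [seq val i | i <- val lam].

(* Zero-based: part lam i is lambda_(i+1), and 0 beyond the last part. *)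
Definition part n (lam : intpartn n) (i : nat) : nat := nth 0%N (parts lam) i.

Lemma parts_is_partition n (lam : intpartn n) : is_partition n (parts lam).
Proof. exact: valP lam. Qed.

Lemma parts_inj n : injective (@parts n).
Proof. by move=> x y /(inj_map val_inj) /val_inj /val_inj. Qed.

Lemma intpartnP n (s : seq nat) :
  is_partition n s -> exists lam : intpartn n, parts lam = s.
Proof.
move=> sP; have [_ s_pos /eqP sum_s] := and3P sP.
have size_s : (size s <= n)%N.
  rewrite -sum_s; elim: s s_pos {sP sum_s} => //= x s IHs.
  rewrite in_cons negb_or => /andP[x_pos /IHs le_s].
  by rewrite -add1n leq_add // lt0n eq_sym.
have le_s : all (fun i => i < n.+1)%N s.
  apply/allP => x xs; rewrite ltnS -sum_s.
  elim: s xs {sP s_pos sum_s size_s} => //= y s IHs.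
  rewrite in_cons => /orP[/eqP ->|/IHs le_x]; first exact: leq_addr.
  exact: leq_trans le_x (leq_addl _ _).
have val_s : [seq val i | i <- [seq inord i : 'I_n.+1 | i <- s]] = s.
  rewrite -map_comp -[RHS]map_id; apply/eq_in_map => x xs /=.
  by rewrite inordK // (allP le_s).
have size_t : (size [seq inord i : 'I_n.+1 | i <- s] <= n)%N by rewrite size_map.
have tP : is_partition n [seq val i | i <- Bseq size_t] by rewrite /= val_s.
by exists (exist _ (Bseq size_t) tP); rewrite /parts /= val_s.
Qed.

Definition lex_lt n (lam kap : intpartn n) : bool :=
  (parts lam < parts kap)%O.

Definition lex_le n (lam kap : intpartn n) : bool :=
  (parts lam <= parts kap)%O.

Lemma lex_leE n (lam kap : intpartn n) :
  lex_le lam kap = (lam == kap) || lex_lt lam kap.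
Proof. by rewrite /lex_le le_eqVlt (inj_eq (@parts_inj n)). Qed.

(* The library order on sequences puts a proper prefix first; as partitions of the
   same n are never proper prefixes of one another, it is the usual one. *)
Lemma lex_ltP n (lam kap : intpartn n) :
  lex_lt lam kap <->
  exists l, (forall i, (i < l)%N -> part kap i = part lam i)
            /\ (part lam l < part kap l)%N.
Proof.
rewrite /lex_lt /part.
have /and3P[_ pos_k _] := parts_is_partition kap.
elim: (parts lam) (parts kap) pos_k => [|x s IHs] [|y t] pos_t.
- by split=> [//|[l [_]]]; rewrite !nth_nil.
- split=> // _; exists 0%N; split=> //=.
  by move: pos_t; rewrite in_cons negb_or lt0n eq_sym => /andP[].
- by split=> [//|[l [_]]]; rewrite nth_nil.
have{}pos_t : 0%N \notin t by move: pos_t; rewrite in_cons negb_or => /andP[].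
rewrite ltxi_cons; split.
- move=> /andP[le_xy /implyP lt_st].
  have [lt_xy|le_yx] := ltnP x y; first by exists 0%N.
  have /(IHs _ pos_t)[l [eq_l lt_l]] := lt_st le_yx.
  exists l.+1; split=> //= -[|i] lt_i /=; last exact: eq_l.
  by apply/eqP; rewrite eqn_leq le_yx; exact: le_xy.
case=> -[|l] [eq_l /= lt_l].
- apply/andP; split; first exact: ltnW.
  by apply/implyP => /(leq_trans lt_l); rewrite ltnn.
have /= eq_xy := eq_l 0%N isT; rewrite eq_xy lexx /=.
by apply/(IHs _ pos_t); exists l; split=> // i lt_i; apply: (eq_l i.+1).
Qed.

Definition rho n (lam : intpartn n) : int :=
  \sum_(i < size (parts lam))
     (part lam i)%:Z * ((part lam i)%:Z - (i.+1)%:Z).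

(* undup keeps one copy of each monomial of the orbit. *)
Definition monomial_sym (R : realFieldType) (q n : nat) (lam : intpartn n)
    : {mpoly R[q]} :=
  if (size (parts lam) <= q)%N then
    \sum_(m <- undup [seq msym s 'X_[[multinom part lam i | i < q]] | s : 'S_q])
       m
  else 0.

(* The denominators y_i - y_j force the values into the fraction field. *)
Definition Delta (R : realFieldType) (q : nat) (f : {mpoly R[q]})
    : {fraction {mpoly R[q]}} :=
  \sum_(i < q)
    (tofrac ('X_i ^+ 2 * (f^`M(i))^`M(i)) +
     \sum_(j < q | j != i)
       tofrac ('X_i ^+ 2) / tofrac ('X_i - 'X_j) * tofrac (f^`M(i))).

Definition zonal_poly (R : realFieldType) (n q : nat)
    (c : intpartn n -> intpartn n -> R) (kap : intpartn n) : {mpoly R[q]} :=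
  \sum_(lam : intpartn n | lex_le lam kap) c kap lam *: monomial_sym R q lam.

Record is_zonal_coeffs (R : realFieldType) (n q : nat)
    (c : intpartn n -> intpartn n -> R) : Prop := IsZonalCoeffs {
  zonal_upper : forall kap lam, lex_lt kap lam -> c kap lam = 0;
  zonal_rho : forall kap lam,
    lex_lt lam kap -> rho kap <= rho lam -> c kap lam = 0;
  zonal_eigen : forall kap,
    Delta (zonal_poly q c kap) =
    tofrac (((rho kap)%:~R + (q%:R - 1) * n%:R) *: zonal_poly q c kap);
  zonal_sum :
    \sum_(kap : intpartn n) zonal_poly q c kap = (\sum_(i < q) 'X_i) ^+ n
}.

(* Main.v *)
Require Import Defs.
From mathcomp Require Import all_boot all_order all_fingroup all_algebra.
From mathcomp.multinomials Require Import mpoly.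
From mathcomp Require Import zify ring lra.

(** The condition on partial sums says that [lam] is not dominated by [kap], so the
   claim is that the coefficient of the zonal polynomial of [kap] at [lam] is nonzero
   exactly when [lam] is dominated by [kap].

   Comparing coefficients in the eigenvalue equation gives the recursion that
   multiplies the coefficient at [lam] by a difference of eigenvalues and equates it
   to a sum, with positive weights, of coefficients at partitions obtained by moving
   boxes of [lam] from a shorter row to a longer one ([zonal_row]). Such raisings
   increase the dominance order, which shows that coefficients vanish outside the
   dominance interval ([zonal_dominated]). Inside it, eigenvalues increase strictly,
   and some raising of a partition strictly dominated by [kap] is still dominated by
   [kap] ([dominated_step]); hence all coefficients have the sign of the diagonal one
   ([eigenfunction_gt0]).

   It remains to see that the diagonal coefficient is positive, which must come from
   the normalization. The recursion is a triangular linear system, of which the zonal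
   coefficients are row eigenvectors. Let [v] be the column eigenvector for [kap],
   supported on partitions that dominate [kap], with [v kap = 1] ([dual_vector]). It
   is orthogonal to the rows of all other partitions, even when eigenvalues coincide,
   because distinct comparable partitions have distinct eigenvalues
   ([zonal_dual_orthogonal]). Summing all the rows gives the multinomial coefficients,
   so the diagonal coefficient is the sum of [v lam] times the multinomial coefficient
   of [lam].

   That multinomial coefficient is also the coefficient of a squarefree monomial in
   the product of the elementary symmetric polynomials of degrees the parts of [lam]
   ([mcoeff_first_ones_mesym_prod]), so the diagonal coefficient is a coefficient of the
   sum of [v lam] times these products. The operator with parameter 2 instead of 1/2
   raises such products by the same matrix as the zonal operator raises monomials
   ([beltrami_mesym_prod]; the instance of the duality of Jack polynomials that
   inverts the parameter). Thus the sum is an eigenfunction of that operator; its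
   monomials are dominated by the conjugate of [kap], where its coefficient is
   positive, and the positivity argument used before applies to it
   ([dual_poly_first_ones_gt0]). *)

Set Implicit Arguments.
Unset Strict Implicit.
Unset Printing Implicit Defensive.
Import Order.TTheory GRing.Theory Num.Theory.
Import Order.DefaultSeqLexiOrder.
Local Open Scope ring_scope.

(** * Dominance of exponent vectors *)

Section Majorization.
Variable q : nat.
Implicit Types (m mu : 'X_{1..q}) (i j : 'I_q).

(** The number of boxes of the diagram of [m] lying beyond column [k]. These numbers
   do not depend on the order of the entries, so comparing them expresses dominance
   without sorting. *)
Definition excess k m : nat := (\sum_(i < q) (m i - k))%N.

Definition dominated m mu : Prop := forall k, (excess k m <= excess k mu)%N.

(** Redistributes the boxes of rows [i] and [j], leaving [s] of them in row [i]. *)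
Definition shift m i j s : 'X_{1..q} :=
  [multinom if k == i then s else if k == j then (m i + m j - s)%N else m k
  | k < q].

(** The eigenvalue attached to an exponent vector is a combination of the next two
   quantities; both increase along dominance, the first one strictly. *)
Definition falling_squares m : nat := (\sum_i m i * (m i).-1)%N.

Definition max_sum m : nat := (\sum_i \sum_(j | j != i) maxn (m i) (m j))%N.

Lemma excess0 m : excess 0 m = mdeg m.
Proof. by rewrite mdegE; apply: eq_bigr => i _; rewrite subn0. Qed.

Lemma excess_eq0 m k : (mdeg m <= k)%N -> excess k m = 0%N.
Proof.
rewrite mdegE => le_k; apply: big1 => i _.
by move: le_k; rewrite (bigD1 i) //=; lia.
Qed.

Lemma dominated_refl m : dominated m m. Proof. by move=> k. Qed.

Lemma dominated_trans m1 m2 m3 :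
  dominated m1 m2 -> dominated m2 m3 -> dominated m1 m3.
Proof. by move=> d12 d23 k; exact: leq_trans (d12 k) (d23 k). Qed.

Lemma sum_shift (F : nat -> nat) m i j s : i != j ->
  (\sum_k F (shift m i j s k) + F (m i) + F (m j)
   = \sum_k F (m k) + F s + F (m i + m j - s))%N.
Proof.
move=> ne_ij; have ne_ji : j != i by rewrite eq_sym.
rewrite (bigD1 i) // (bigD1 j) //= !mnmE eqxx (negPf ne_ji) eqxx.
rewrite [X in (_ = X + _ + _)%N](bigD1 i) // (bigD1 j (P := predC1 i)) //=.
under eq_bigr => k /andP[/negPf ki /negPf kj] do rewrite mnmE ki kj.
set S := bigop _ _ _; lia.
Qed.

Lemma mdeg_shift m i j s : i != j -> (s <= m i + m j)%N ->
  mdeg (shift m i j s) = mdeg m.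
Proof.
by move=> ne_ij le_s; rewrite !mdegE; have := sum_shift id m s ne_ij; lia.
Qed.

Lemma excess_shift k m i j s : i != j ->
  (excess k (shift m i j s) + (m i - k) + (m j - k)
   = excess k m + (s - k) + (m i + m j - s - k))%N.
Proof. exact: (sum_shift (fun x => x - k)%N). Qed.

Lemma dominated_shift m i j s : i != j ->
  (maxn (m i) (m j) < s <= m i + m j)%N -> dominated m (shift m i j s).
Proof. by move=> ne_ij hs k; have := excess_shift k m s ne_ij; lia. Qed.

Lemma excess_shift_lt m i j s : i != j ->
  (maxn (m i) (m j) < s <= m i + m j)%N ->
  (excess (maxn (m i) (m j)) m < excess (maxn (m i) (m j)) (shift m i j s))%N.
Proof.
by move=> ne_ij hs; have := excess_shift (maxn (m i) (m j)) m s ne_ij; lia.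
Qed.

(** Summing [x - k] over [k] gives a triangular number, so the sum of squares is a
   sum of excesses; this is how strict dominance becomes a strict inequality. *)
Lemma falling_squaresE m b : (mdeg m <= b)%N ->
  (falling_squares m + 2 * mdeg m = 2 * \sum_(k < b) excess k m)%N.
Proof.
have sumE x : forall b, (x <= b -> 2 * \sum_(k < b) (x - k) = x * x.+1)%N.
  elim: x => [|x IHx] c le_xc; first by rewrite big1.
  case: c le_xc => // c le_xc; rewrite big_ord_recl /= mulnDr.
  have := IHx c le_xc; under eq_bigr => k _ do rewrite /bump subSS.
  by move=> ->; lia.
move=> le_b; rewrite exchange_big mdegE !big_distrr -big_split /=.
apply: eq_bigr => i _; rewrite sumE; first by case: (m i) => *; nia.
by apply: leq_trans le_b; rewrite mdegE (bigD1 i) //= leq_addr.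
Qed.

Lemma leq_falling_squares m mu : mdeg m = mdeg mu -> dominated m mu ->
  (falling_squares m <= falling_squares mu)%N.
Proof.
move=> eq_deg d; have := falling_squaresE (leqnn (mdeg mu)).
have := falling_squaresE (eq_leq eq_deg); rewrite eq_deg.
have : (\sum_(k < mdeg mu) excess k m <= \sum_(k < mdeg mu) excess k mu)%N.
  by apply: leq_sum => k _; exact: d.
lia.
Qed.

Lemma ltn_falling_squares m mu k : mdeg m = mdeg mu -> dominated m mu ->
  (excess k m < excess k mu)%N -> (falling_squares m < falling_squares mu)%N.
Proof.
move=> eq_deg d lt_k.
pose b := (k + mdeg mu).+1.
have le_b : (mdeg mu <= b)%N by rewrite /b; lia.
have := falling_squaresE le_b.
have := @falling_squaresE m b; rewrite eq_deg => /(_ le_b).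
have lt_kb : (k < b)%N by rewrite /b; lia.
have : (\sum_(k < b) excess k m < \sum_(k < b) excess k mu)%N.
  rewrite (bigD1 (Ordinal lt_kb)) //= [ltnRHS](bigD1 (Ordinal lt_kb)) //=.
  by rewrite -addSn leq_add // leq_sum.
lia.
Qed.

Lemma max_sumE m :
  (max_sum m + mdeg m = q * mdeg m + \sum_i \sum_j (m j - m i))%N.
Proof.
rewrite !mdegE big_distrr -!big_split /=; apply: eq_bigr => i _.
have -> : (q * m i = \sum_(j < q) m i)%N by rewrite sum_nat_const card_ord.
rewrite -big_split /= [RHS](bigD1 i) //= subnn addn0 addnC; congr addn.
by apply: eq_bigr => j _; rewrite maxnE.
Qed.

(** Up to terms that depend on the degree alone, [max_sum] is a double sum of
   truncated differences. For a fixed subtrahend, the sum over the other index is an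
   excess, and by symmetry so is the sum over the subtrahend up to a constant; the
   two indices are therefore passed from [m] to [mu] one after the other. *)
Lemma leq_max_sum m mu : mdeg m = mdeg mu -> dominated m mu ->
  (max_sum m <= max_sum mu)%N.
Proof.
move=> eq_deg d; have := max_sumE m; have := max_sumE mu; rewrite eq_deg.
suff : (\sum_i \sum_j (m j - m i) <= \sum_i \sum_j (mu j - mu i))%N by lia.
apply: (@leq_trans (\sum_i \sum_j (mu j - m i))%N).
  by apply: leq_sum => i _; exact: d.
rewrite exchange_big [leqRHS]exchange_big /=; apply: leq_sum => j _.
have subE (m' : 'X_{1..q}) c :
    (\sum_i (c - m' i) + mdeg m' = q * c + excess c m')%N.
  have -> : (q * c = \sum_(i < q) c)%N by rewrite sum_nat_const card_ord.
  by rewrite mdegE -!big_split; apply: eq_bigr => i _ /=; lia.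
by rewrite -(leq_add2r (mdeg mu)) subE -eq_deg subE leq_add2l.
Qed.

Lemma card_gtE m k : (#|[set i | k < m i]| = excess k m - excess k.+1 m)%N.
Proof.
suff : (#|[set i | k < m i]| + excess k.+1 m = excess k m)%N by lia.
rewrite -sum1dep_card big_mkcond -big_split /=; apply: eq_bigr => i _.
by case: ifP => /=; lia.
Qed.

Lemma excessS m k : (excess k.+1 m <= excess k m)%N.
Proof. by apply: leq_sum => i _; lia. Qed.

(** On a maximal interval where the excesses of [m] stay strictly below those of
   [mu], the difference leaves zero and returns to it, so [m] has at least two
   entries strictly inside; one box can be moved between these two. *)
Lemma dominated_step m mu k0 : mdeg m = mdeg mu -> dominated m mu ->
  (excess k0 m < excess k0 mu)%N ->
  exists i j, [/\ i != j, ((maxn (m i) (m j)).+1 <= m i + m j)%N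
                & dominated (shift m i j (maxn (m i) (m j)).+1) mu].
Proof.
move=> eq_deg d lt_k0.
have hi_ex : exists b, (k0 < b)%N && (excess b m == excess b mu).
  exists (k0 + mdeg mu).+1; by rewrite !excess_eq0 ?eq_deg; lia.
have [b /andP[lt_k0b /eqP eq_b] b_min] := ex_minnP hi_ex.
have lo_ex : exists a, (a < k0)%N && (excess a m == excess a mu).
  exists 0%N; rewrite !excess0 eq_deg eqxx andbT lt0n.
  by apply: contraTneq lt_k0 => ->; rewrite !excess0 eq_deg ltnn.
have lo_ub : forall a, (a < k0)%N && (excess a m == excess a mu) -> (a <= k0)%N.
  by move=> a /andP[/ltnW].
have [a /andP[lt_ak0 /eqP eq_a] a_max] := ex_maxnP lo_ex lo_ub.
have strict k : (a < k < b)%N -> (excess k m < excess k mu)%N.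
  move=> /andP[lt_ak lt_kb]; rewrite ltn_neqAle d andbT.
  apply/negP => eq_k; have [lt_k|lt_k|eq_kk] := ltngtP k k0.
  - by have := a_max k; rewrite lt_k eq_k => /(_ isT); lia.
  - by have := b_min k; rewrite lt_k eq_k => /(_ isT); lia.
  - by move: lt_k0 eq_k; rewrite -eq_kk => lt_k /eqP; lia.
have cardE : (#|[set i | a < m i < b]| + #|[set i | b.-1 < m i]|
              = #|[set i | a < m i]|)%N.
  rewrite -!sum1dep_card !(big_mkcond (fun i => _ < m i)%N) /=.
  rewrite (big_mkcond (fun i => _ < m i < b)%N) -big_split /=.
  by apply: eq_bigr => i _; do 3! case: ifP; lia.
have cards_mu : (#|[set i | b.-1 < mu i]| <= #|[set i | a < mu i]|)%N.
  apply: subset_leq_card; apply/subsetP => i; rewrite !inE; lia.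
have two : (1 < #|[set i | a < m i < b]|)%N.
  move: cardE cards_mu; rewrite !card_gtE prednK; last by lia.
  have := @strict a.+1; have := @strict b.-1; rewrite eq_a eq_b => sb sa.
  have /sa : (a < a.+1 < b)%N by lia.
  have /sb : (a < b.-1 < b)%N by lia.
  have := excessS mu a; have := excessS m a; have := excessS mu b.-1.
  have := excessS m b.-1; rewrite prednK; last by lia.
  lia.
have [i [j [i_in j_in ne_ij]]] := card_gt1P two.
move: i_in j_in; rewrite !inE => /andP[ai ib] /andP[aj jb].
have le_s : ((maxn (m i) (m j)).+1 <= m i + m j)%N by lia.
exists i, j; split=> // k.
have := excess_shift k m (maxn (m i) (m j)).+1 ne_ij.
have [in_ab|out_ab] := boolP (a < k < b)%N; first by have := strict k in_ab; lia.
by have := d k; lia.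
Qed.

(** The number of entries equal to [k] is a second difference of excesses. *)
Lemma excess_inj_perm m mu : (forall k, excess k m = excess k mu) ->
  exists s : 'S_q, m = [multinom mu (s i) | i < q].
Proof.
move=> eq_ex.
have card_eq k : #|[set i | m i == k]| = #|[set i | mu i == k]|.
  have cardE (m' : 'X_{1..q}) : (#|[set i | m' i == k]| + #|[set i | k < m' i]|
      = if k is k'.+1 then #|[set i | (k' < m' i)%N]| else q)%N.
    have -> : (if k is k'.+1 then #|[set i | (k' < m' i)%N]| else q)
              = #|[set i | (k <= m' i)%N]|.
      by case: k => [|k] //; rewrite -[LHS]card_ord -cardsT; congr #|pred_of_set _|;
        apply/setP => i; rewrite !inE.
    rewrite -!sum1dep_card (big_mkcond (fun i => m' i == k)).
    rewrite (big_mkcond (fun i => k < m' i)%N) -big_split /=.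
    rewrite [RHS]big_mkcond; apply: eq_bigr => i _.
    by case: (ltngtP (m' i) k).
  have := cardE m; have := cardE mu.
  by case: (k) => [|k']; rewrite !card_gtE !eq_ex; lia.
have /tuple_permP[s eq_s] : perm_eq m mu.
  apply/allP => k _ /=; apply/eqP.
  have countE (m' : 'X_{1..q}) : count_mem k m' = #|[set i | m' i == k]|.
    have -> : (m' : seq nat) = [seq m' i | i <- enum 'I_q].
      by rewrite -[in LHS](map_tnth_enum m').
    rewrite count_map cardsE cardE size_filter enumT; exact: eq_count.
  by rewrite !countE.
exists s; apply/mnmP => i; rewrite mnmE.
rewrite [LHS](_ : _ = tnth m i) // [RHS](_ : _ = tnth mu (s i)) //.
by rewrite (tnth_nth 0%N) eq_s -tnth_nth tnth_mktuple.
Qed.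

End Majorization.

(** * The operator on coefficients, and positivity *)

Section Raising.
Variables (q : nat) (V : zmodType).

(** The two-body part of the operator: each pair of rows is visited twice, once in
   either order, and boxes are moved from the shorter row to the longer one. The
   weight [s.*2 - (m i + m j)] is the difference of the new row lengths. *)
Definition raising (g : 'X_{1..q} -> V) (m : 'X_{1..q}) : V :=
  \sum_i \sum_(j | j != i)
    \sum_((maxn (m i) (m j)).+1 <= s < (m i + m j).+1)
      g (shift m i j s) *+ (s.*2 - (m i + m j)).

End Raising.

Section Beltrami.
Variables (R : realFieldType) (q : nat).
Implicit Types (f G : {mpoly R[q]}) (m mu : 'X_{1..q}) (i j : 'I_q).

Lemma mcoeffXM i f m :
  ('X_i * f)@_m = if m i == 0%N then 0 else f@_(m - U_(i)).
Proof.
case: eqP => [mi0|/eqP mi].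
  apply: memN_msupp_eq0; apply/negP => /msuppM_le /allpairsP[[m1 m2] /= []].
  rewrite msuppX inE => /eqP -> _ def_m.
  by move: mi0; rewrite def_m mnmDE mnm1E eqxx.
have {1}-> : m = (U_(i) + (m - U_(i)))%MM by rewrite addmC submK ?lep1mP.
by rewrite mulrC mcoeffMX.
Qed.

Lemma mcoeff_euler i f m : ('X_i * f^`M(i))@_m = (m i)%:R * f@_m.
Proof.
rewrite mcoeffXM; case: eqP => [->|/eqP mi]; first by rewrite mul0r.
rewrite mcoeff_deriv mnmBE mnm1E eqxx submK ?lep1mP // subn1 prednK ?lt0n //.
by rewrite mulr_natl.
Qed.

Lemma mcoeff_euler2 i f m :
  ('X_i ^+ 2 * (f^`M(i))^`M(i))@_m = (m i * (m i).-1)%:R * f@_m.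
Proof.
rewrite expr2 -mulrA mcoeffXM; case: eqP => [->|/eqP mi]; first by rewrite mul0r.
rewrite mcoeff_euler mcoeff_deriv mnmBE mnm1E eqxx submK ?lep1mP //.
rewrite subn1 prednK ?lt0n // -[f@_m *+ _]mulr_natl natrM; ring.
Qed.

(** [G] is the quotient of the antisymmetric polynomial on the right by
   ['X_i - 'X_j]; it is a relation because the quotient need not exist. *)
Definition divided_difference i j f G :=
  ('X_i - 'X_j) * G = 'X_i ^+ 2 * f^`M(i) - 'X_j ^+ 2 * f^`M(j).

Lemma divided_differenceC i j f G :
  divided_difference i j f G -> divided_difference j i f G.
Proof.
rewrite /divided_difference => dG.
by rewrite -[LHS]opprK -mulNr opprB dG opprB.
Qed.

Lemma shift_shift m i j s t : i != j -> (s <= m i + m j)%N ->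
  shift (shift m i j s) i j t = shift m i j t.
Proof.
move=> ne_ij le_s; apply/mnmP => k; rewrite !mnmE !eqxx [j == i]eq_sym (negPf ne_ij).
by rewrite subnKC //; case: (k == i); case: (k == j).
Qed.

(** Comparing coefficients in the defining identity moves one unit of exponent
   from [j] to [i] at a time, until the exponent of [j] is exhausted. *)
Lemma mcoeff_divided_difference i j f G m :
  i != j -> divided_difference i j f G ->
  G@_m = (m i)%:R * f@_m
    + \sum_((m i).+1 <= s < (m i + m j).+1)
        (s%:R *+ 2 - (m i + m j)%:R) * f@_(shift m i j s).
Proof.
move=> ne_ij dG; have [k] := ubnP (m j); elim: k m => // k IHk m le_k.
have ji : (j == i) = false by rewrite eq_sym; exact: negPf.
have := congr1 (mcoeff (m + U_(i))) dG.
rewrite mulrBl !mcoeffB !mcoeffXM !mnmDE !mnm1E eqxx addn1 /=.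
rewrite (negPf ne_ij) addn0 addmK !expr2 -!mulrA.
rewrite 2!(mcoeffXM _ ('X__ * _)) !mnmDE !mnm1E eqxx (negPf ne_ij) addn1 addn0 /=.
rewrite addmK !mcoeff_euler.
case: eqP => [mj0 | /eqP mj].
  by rewrite !subr0 mj0 addn0 big_geq // addr0.
have -> : (m + U_(i) - U_(j))%MM = shift m i j (m i).+1.
  apply/mnmP => l; rewrite mnmBE mnmDE !mnm1E mnmE [l == i]eq_sym [l == j]eq_sym.
  case: (eqVneq i l) => [<-|_]; first by rewrite ji addn1 subn0; lia.
  case: (eqVneq j l) => [<-|_]; rewrite ?addn0 ?subn0 //; lia.
set m' := shift m i j (m i).+1.
have m'i : m' i = (m i).+1 by rewrite mnmE eqxx.
have m'j : m' j = (m j).-1 by rewrite mnmE ji eqxx; lia.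
have lt_mj : (m i < m i + m j)%N by lia.
rewrite (big_ltn (n := (m i + m j).+1)) ?ltnS //.
have -> : G@_m' = (m i).+1%:R * f@_m'
    + \sum_((m i).+2 <= s < (m i + m j).+1)
        (s%:R *+ 2 - (m i + m j)%:R) * f@_(shift m i j s).
  have sum_m' : ((m i).+1 + (m j).-1 = m i + m j)%N by lia.
  rewrite IHk; last by rewrite m'j; lia.
  rewrite m'i m'j sum_m'.
  by congr (_ + _); apply: eq_bigr => s _; rewrite shift_shift.
rewrite -/m'; set S := bigop _ _ _; move=> /eqP; rewrite subr_eq => /eqP ->.
rewrite m'j natrD; have -> : (m j)%:R = (m j).-1%:R + 1 :> R.
  by rewrite natr1 prednK ?lt0n.
rewrite -natr1; ring.
Qed.

Definition perm_invariant (T : Type) (g : 'X_{1..q} -> T) :=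
  forall (s : 'S_q) m, g [multinom m (s i) | i < q] = g m.

Lemma symmetric_invariant f : f \is symmetric -> perm_invariant (fun m => f@_m).
Proof. by move=> /issymP sym_f s m; rewrite -mcoeff_sym sym_f. Qed.

Lemma shiftC m i j s : i != j ->
  shift m j i s = [multinom shift m i j s (tperm i j k) | k < q].
Proof.
move=> ne_ij; apply/mnmP => k; rewrite !mnmE addnC.
case: tpermP => [->|->|/eqP/negPf ki /eqP/negPf kj].
- by rewrite (negPf ne_ij) !eqxx [j == i]eq_sym (negPf ne_ij).
- by rewrite !eqxx.
- by rewrite ki kj.
Qed.

(** The previous formula holds for either order of the two variables; applying it
   with the larger exponent first leaves positive weights only. *)
Lemma mcoeff_divided_difference_sym i j f G m :
  i != j -> f \is symmetric -> divided_difference i j f G ->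
  G@_m = (maxn (m i) (m j))%:R * f@_m
    + \sum_((maxn (m i) (m j)).+1 <= s < (m i + m j).+1)
        f@_(shift m i j s) *+ (s.*2 - (m i + m j)).
Proof.
move=> ne_ij sym_f; wlog le_ij : i j ne_ij / (m j <= m i)%N => [IH dG|dG].
  have /orP[le_ji|le_ij] := leq_total (m j) (m i); first exact: IH.
  have ne_ji : j != i by rewrite eq_sym.
  rewrite (IH _ _ ne_ji le_ij (divided_differenceC dG)) (maxnC (m j)) (addnC (m j)).
  congr (_ + _); apply: eq_bigr => s _.
  by rewrite (shiftC m s ne_ij) (symmetric_invariant sym_f).
rewrite (mcoeff_divided_difference m ne_ij dG) (maxn_idPl le_ij); congr (_ + _).
apply: eq_big_nat => s /andP[lt_s le_s].
by rewrite -mulrnA muln2 -natrB ?mulr_natl //; lia.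
Qed.

(** The eigenvalue equation, coefficient by coefficient, of the second-order Euler
   operator plus [b] times the sum of all divided differences over ordered pairs.
   The zonal operator is the case [b = 1/2]; its dual is the case [b = 2]. *)
Definition eigenfunction (b e : R) (g : 'X_{1..q} -> R) := forall m,
  (falling_squares m)%:R * g m + b * ((max_sum m)%:R * g m + raising g m)
  = e * g m.

Lemma eigenfunction_mcoeff b e f (G : 'I_q -> 'I_q -> {mpoly R[q]}) :
  f \is symmetric ->
  (forall i j, j != i -> divided_difference i j f (G i j)) ->
  \sum_i 'X_i ^+ 2 * (f^`M(i))^`M(i) + b *: \sum_i \sum_(j | j != i) G i j
    = e *: f ->
  eigenfunction b e (fun m => f@_m).
Proof.
move=> sym_f dG eq_f m /=; rewrite -[RHS]mcoeffZ -eq_f mcoeffD mcoeffZ.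
rewrite /falling_squares /max_sum !natr_sum !big_distrl !linear_sum /=.
congr (_ + _ * _); first by apply: eq_bigr => i _; rewrite mcoeff_euler2.
rewrite -big_split /=; apply: eq_bigr => i _.
rewrite natr_sum big_distrl -big_split linear_sum /=; apply: eq_bigr => j ne_ji.
by rewrite (mcoeff_divided_difference_sym _ _ sym_f (dG i j ne_ji)) // eq_sym.
Qed.

Section Positivity.
Variables (b e : R) (g : 'X_{1..q} -> R) (mu : 'X_{1..q}).
Hypotheses (b_gt0 : 0 < b) (sym_g : perm_invariant g).
Hypothesis eigen_g : eigenfunction b e g.
Hypothesis supp_g : forall m, g m != 0 -> mdeg m = mdeg mu /\ dominated m mu.
Hypothesis mu_gt0 : 0 < g mu.

(** The eigenvalue is read off at [mu], whose raisings are no longer dominated by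
   [mu]. *)
Lemma eigenvalue_top :
  e = (falling_squares mu)%:R + b * (max_sum mu)%:R.
Proof.
have := eigen_g mu; rewrite [raising _ _]big1 => [|i _].
  rewrite addr0 mulrA -mulrDl => /(mulIf (lt0r_neq0 mu_gt0)) -> //.
apply: big1 => j ne_ji; apply: big1_seq => s /=; rewrite mem_index_iota => hs.
have ne_ij : i != j by rewrite eq_sym.
have [->|/supp_g[_ /(_ (maxn (mu i) (mu j)))]] := eqVneq (g (shift mu i j s)) 0.
  by rewrite mul0rn.
by have := @excess_shift_lt _ mu i j s ne_ij; rewrite hs => /(_ isT); lia.
Qed.

(** Below [mu] the equation expresses a value as a sum of nonnegative raised values
   over a positive gap of eigenvalues, and [dominated_step] provides a raised
   value which is positive by induction. *)
Lemma eigenfunction_gt0 m : mdeg m = mdeg mu -> dominated m mu -> 0 < g m.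
Proof.
have [k] := ubnP (falling_squares mu - falling_squares m).
elim: k m => // k IHk m le_k deg_m dom_m.
have [/forallP eq_ex | ] :=
    boolP [forall l : 'I_(mdeg mu).+1, excess l m == excess l mu].
  suff [s ->] : exists s : 'S_q, m = [multinom mu (s i) | i < q].
    by rewrite sym_g.
  apply: excess_inj_perm => l; have [lt_l|le_l] := ltnP l (mdeg mu).+1.
    exact/eqP/(eq_ex (Ordinal lt_l)).
  by rewrite !excess_eq0 // ?deg_m ltnW.
rewrite negb_forall => /existsP[l ne_l].
have lt_l : (excess l m < excess l mu)%N by rewrite ltn_neqAle ne_l dom_m.
have lt_fs := ltn_falling_squares deg_m dom_m lt_l.
have le_ms := leq_max_sum deg_m dom_m.
have IH i j s : i != j -> (maxn (m i) (m j) < s <= m i + m j)%N ->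
    dominated (shift m i j s) mu -> 0 < g (shift m i j s).
  move=> ne_ij hs dom_s; have deg_s : mdeg (shift m i j s) = mdeg m.
    by apply: mdeg_shift => //; case/andP: hs.
  apply: IHk; rewrite ?deg_s //.
  have := ltn_falling_squares (esym deg_s) (dominated_shift ne_ij hs)
            (excess_shift_lt ne_ij hs).
  by lia.
have g_ge0 i j s : i != j -> (maxn (m i) (m j) < s <= m i + m j)%N ->
    0 <= g (shift m i j s).
  move=> ne_ij hs; have [-> //|/supp_g[_ dom_s]] := eqVneq (g (shift m i j s)) 0.
  exact/ltW/IH.
have term_ge0 i j s : i != j -> (maxn (m i) (m j) < s < (m i + m j).+1)%N ->
    0 <= g (shift m i j s) *+ (s.*2 - (m i + m j)).
  by move=> ne_ij hs; rewrite mulrn_wge0 // g_ge0.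
have [i [j [ne_ij le_s dom_s]]] := dominated_step deg_m dom_m lt_l.
have raising_gt0 : 0 < raising g m.
  have ne_ji : j != i by rewrite eq_sym.
  rewrite /raising (bigD1 i) //= (bigD1 j) //= big_ltn ?ltnS //=.
  have pos_s : 0 < g (shift m i j (maxn (m i) (m j)).+1)
                 *+ ((maxn (m i) (m j)).+1.*2 - (m i + m j)).
    by rewrite pmulrn_lgt0; [apply: IH => //; rewrite ltnSn | lia].
  rewrite -!addrA ltr_wpDr // addr_ge0 //.
    by rewrite big_nat_cond sumr_ge0 // => s; rewrite andbT => hs;
      apply: term_ge0 => //; lia.
  rewrite addr_ge0 //; first apply: sumr_ge0 => j' /andP[ne_j' _].
    rewrite big_nat_cond sumr_ge0 // => s; rewrite andbT => hs.
    by apply: term_ge0 => //; rewrite eq_sym.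
  apply: sumr_ge0 => i' _; apply: sumr_ge0 => j' ne_j'.
  rewrite big_nat_cond sumr_ge0 // => s; rewrite andbT => hs.
  by apply: term_ge0 => //; rewrite eq_sym.
have := eigen_g m; rewrite eigenvalue_top => eq_m.
have gap : (falling_squares mu)%:R + b * (max_sum mu)%:R
           - ((falling_squares m)%:R + b * (max_sum m)%:R) > 0 :> R.
  have : b * (max_sum m)%:R <= b * (max_sum mu)%:R.
    by rewrite ler_pM2l // ler_nat.
  by have : (falling_squares m)%:R < (falling_squares mu)%:R :> R;
    [rewrite ltr_nat | lra].
rewrite -(pmulr_rgt0 _ gap) (_ : _ * g m = b * raising g m) ?mulr_gt0 //.
by rewrite mulrBl -eq_m; ring.
Qed.

End Positivity.

End Beltrami.

(** * The operator on products of elementary symmetric polynomials *)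

Section Elementary.
Variables (R : realFieldType) (q : nat).
Implicit Types (f G : {mpoly R[q]}) (m : 'X_{1..q}) (i j : 'I_q).
Local Notation el k := (mesym q R k).

Lemma mderiv_mesym0 i : (el 0)^`M(i) = 0.
Proof. by rewrite mesym0E -mpolyC1 mderivC. Qed.

Lemma mechar_le1 k m i : mechar k m -> (m i <= 1)%N.
Proof. by move=> /andP[_ /forallP]. Qed.

Lemma mderiv_mesymS i k : (el k.+1)^`M(i) = el k - 'X_i * (el k)^`M(i).
Proof.
apply/mpolyP => m; rewrite mcoeff_deriv mcoeffB mcoeff_euler !mcoeff_mesym.
have -> : mechar k.+1 (m + U_(i))%MM = mechar k m && (m i == 0%N).
  rewrite /mechar mdegD mdeg1 addn1 eqSS -andbA; congr (_ && _).
  apply/forallP/andP => [le1|[/forallP le1 /eqP mi0] j].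
    split; last by have := le1 i; rewrite mnmDE mnm1E eqxx; lia.
    by apply/forallP => j; have := le1 j; rewrite mnmDE; lia.
  rewrite mnmDE mnm1E; have := le1 j.
  by case: eqVneq => [<-|_]; rewrite ?mi0 ?addn0.
have [ch|_] := boolP (mechar k m); last by rewrite mulr0 subr0 mul0rn.
by have := mechar_le1 i ch; case: (m i) => [|[|]] //=;
  rewrite ?mul0r ?subr0 ?mulr1 ?subrr ?mul0rn.
Qed.

Lemma mderiv2_mesym i k : ((el k)^`M(i))^`M(i) = 0.
Proof.
apply/mpolyP => m; rewrite !mcoeff_deriv mcoeff0 mcoeff_mesym.
suff /negPf -> : ~~ mechar k (m + U_(i) + U_(i))%MM by rewrite !mul0rn.
by apply/negP => /(@mechar_le1 _ _ i); rewrite !mnmDE !mnm1E eqxx; lia.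
Qed.

Lemma sum_euler_mesym k : \sum_i 'X_i * (el k)^`M(i) = k%:R * el k.
Proof.
apply/mpolyP => m; rewrite raddf_sum /= mulr_natl mcoeffMn.
under eq_bigr => i _ do rewrite mcoeff_euler.
rewrite -big_distrl /= -natr_sum -mdegE mcoeff_mesym.
have [/andP[/eqP -> _]|_] := boolP (mechar k m); last by rewrite mulr0 mul0rn.
by rewrite mulr1.
Qed.

Lemma mderivXU_neq i j : j != i -> ('X_i : {mpoly R[q]})^`M(j) = 0.
Proof. by move=> ne; rewrite mderivX mnm1E eq_sym (negPf ne); exact: scale0r. Qed.

(** The divided difference of an elementary symmetric polynomial: writing it as
   [A + ('X_i + 'X_j) B + 'X_i 'X_j C], this is [('X_i + 'X_j) B + 'X_i 'X_j C]. *)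
Definition mesym_quotient i j k :=
  'X_i * (el k)^`M(i) + 'X_j * (el k)^`M(j)
    - 'X_i * ('X_j * ((el k)^`M(j))^`M(i)).

Lemma mesym_quotientP i j k : j != i ->
  divided_difference i j (el k) (mesym_quotient i j k).
Proof.
move=> ne_ji; rewrite /divided_difference /mesym_quotient.
suff eq_d : (el k)^`M(j) - (el k)^`M(i)
    = ('X_i - 'X_j) * ((el k)^`M(j))^`M(i).
  set d := (_^`M(j))^`M(i) in eq_d *.
  have -> : (el k)^`M(j) = (el k)^`M(i) + ('X_i - 'X_j) * d.
    by rewrite -eq_d addrC subrK.
  ring.
case: k => [|k]; first by rewrite !mderiv_mesym0 mderiv0 subrr mulr0.
have dij : ((el k.+1)^`M(j))^`M(i)
    = (el k)^`M(i) - 'X_j * ((el k)^`M(j))^`M(i).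
  by rewrite mderiv_mesymS mderivB mderivM mderivXU_neq 1?eq_sym // mul0r add0r.
have dji : ((el k.+1)^`M(j))^`M(i)
    = (el k)^`M(j) - 'X_i * ((el k)^`M(j))^`M(i).
  by rewrite mderiv_comm mderiv_mesymS mderivB mderivM mderivXU_neq // mul0r add0r
    mderiv_comm.
rewrite mulrBl {1}dij dji !mderiv_mesymS; ring.
Qed.

Lemma sum_neq (V : zmodType) (F : 'I_q -> V) i :
  \sum_(j | j != i) F j = \sum_j F j - F i.
Proof. by rewrite [X in _ = X - _](bigD1 i) //= addrAC subrr add0r. Qed.

(** On a squarefree monomial each unordered pair of variables contributes twice the
   number 0 or 1 that tells whether the pair meets the monomial, so the sum is a
   scalar. *)
Lemma sum_mesym_quotient k :
  \sum_i \sum_(j | j != i) mesym_quotient i j k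
    = (2 * (q%:R - 1) * k%:R - (k * k.-1)%:R) *: el k.
Proof.
apply/mpolyP => m; rewrite raddf_sum mcoeffZ /=.
have coefE i j : j != i -> (mesym_quotient i j k)@_m
    = ((m i)%:R + (m j)%:R - (m i)%:R * (m j)%:R) * (el k)@_m.
  move=> ne_ji; rewrite mcoeffB mcoeffD !mcoeff_euler.
  have -> : 'X_j * ((el k)^`M(j))^`M(i) = ('X_j * (el k)^`M(j))^`M(i).
    by rewrite mderivM mderivXU_neq 1?eq_sym // mul0r add0r.
  by rewrite !mcoeff_euler; ring.
under eq_bigr => i _ do rewrite raddf_sum /= (eq_bigr _ (coefE i)) -big_distrl.
rewrite -big_distrl /= mcoeff_mesym.
have [/andP[/eqP deg_m /forallP le1]|_] := boolP (mechar k m); last by rewrite !mulr0.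
congr (_ * _).
have sumE : \sum_i (m i)%:R = k%:R :> R by rewrite -natr_sum -mdegE deg_m.
have rowE i : \sum_(j | j != i) ((m i)%:R + (m j)%:R - (m i)%:R * (m j)%:R)
    = (q%:R - 1 - k%:R) * (m i)%:R + k%:R :> R.
  rewrite sum_neq sumrB big_split /= sumr_const card_ord -big_distrr /= sumE.
  rewrite -mulr_natl; have := le1 i; case: (m i) => [|[|]] // _; ring.
rewrite (eq_bigr _ (fun i _ => rowE i)) big_split /= -big_distrr /= sumE.
rewrite sumr_const card_ord -mulr_natl.
case: (k) => [|k']; first by rewrite mul0n; ring.
by rewrite natrM -[k'.+1.-1]/k' -natr1; ring.
Qed.

Lemma mderiv_prod (I : finType) (P : pred I) (F : I -> {mpoly R[q]}) i :
  (\prod_(k | P k) F k)^`M(i)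
    = \sum_(k | P k) (F k)^`M(i) * \prod_(l | P l && (l != k)) F l.
Proof.
elim: (index_enum I) (index_enum_uniq I) => [|k r IHr] /=.
  by rewrite !big_nil -mpolyC1 mderivC.
move=> /andP[k_r /IHr{}IHr]; rewrite !big_cons.
have neq_k l : l \in r -> (l != k) by apply: contraTneq => ->.
have tailE : \sum_(l <- r | P l) (F l)^`M(i)
      * \prod_(l' <- k :: r | P l' && (l' != l)) F l'
    = (if P k then F k else 1) * \sum_(l <- r | P l) (F l)^`M(i)
      * \prod_(l' <- r | P l' && (l' != l)) F l'.
  rewrite big_distrr /= big_seq_cond [RHS]big_seq_cond.
  apply: eq_bigr => l /andP[/neq_k ne_lk _]; rewrite big_cons eq_sym ne_lk andbT.
  by case: (P k); rewrite ?mul1r // mulrCA.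
case Pk : (P k); last by rewrite tailE Pk mul1r.
rewrite mderivM IHr tailE Pk; congr (_ * _ + _).
rewrite eqxx /= big_seq_cond [RHS]big_seq_cond.
by apply: eq_bigl => l; case: (boolP (l \in r)) => //= /neq_k ->; rewrite andbT.
Qed.

Definition mesym_prod m : {mpoly R[q]} := \prod_k el (m k).

Definition mesym_prod_quotient m i j : {mpoly R[q]} :=
  \sum_k mesym_quotient i j (m k) * \prod_(l | l != k) el (m l).

Lemma mesym_prod_quotientP m i j : j != i ->
  divided_difference i j (mesym_prod m) (mesym_prod_quotient m i j).
Proof.
move=> ne_ji; rewrite /divided_difference /mesym_prod !mderiv_prod /=.
rewrite !big_distrr -sumrB; apply: eq_bigr => k _ /=.
by rewrite !mulrA -mulrBl (mesym_quotientP _ ne_ji).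
Qed.

Lemma sum_mesym_prod_quotient m :
  \sum_i \sum_(j | j != i) mesym_prod_quotient m i j
    = (2 * (q%:R - 1) * (mdeg m)%:R - (falling_squares m)%:R) *: mesym_prod m.
Proof.
under eq_bigr => i _ do rewrite exchange_big /=.
rewrite exchange_big /=.
have termE k : \sum_i \sum_(j | j != i)
      mesym_quotient i j (m k) * \prod_(l | l != k) el (m l)
    = (2 * (q%:R - 1) * (m k)%:R - (m k * (m k).-1)%:R) *: mesym_prod m.
  under [LHS]eq_bigr => i _ do rewrite -mulr_suml.
  rewrite -mulr_suml sum_mesym_quotient -scalerAl; congr (_ *: _).
  by rewrite /mesym_prod [RHS](bigD1 k).
rewrite (eq_bigr _ (fun k _ => termE k)) -scaler_suml sumrB -big_distrr /=.
by rewrite -!natr_sum -mdegE.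
Qed.

(** Since ['X_i * (el k.+1)^`M(i) = 'X_i * (el k - 'X_i * (el k)^`M(i))], the sums
   for [(a.+1, b)] and [(a, b.+1)] differ by two Euler sums, which are multiples of
   [el a.+1 * el b] and [el a * el b.+1]; the formula collects these differences. *)
Lemma mesym_cross_product a b :
  \sum_i ('X_i * (el a)^`M(i)) * ('X_i * (el b)^`M(i))
  = b%:R * el a * el b
    - \sum_(a.+1 <= s < (a + b).+1)
        (s%:R *+ 2 - (a + b)%:R) * (el s * el (a + b - s)).
Proof.
have XdS k i : 'X_i * (el k.+1)^`M(i) = 'X_i * (el k - 'X_i * (el k)^`M(i)).
  by rewrite mderiv_mesymS.
elim: b a => [|b IHb] a.
  rewrite addn0 big_geq // !mul0r subr0; apply: big1 => i _.
  by rewrite mderiv_mesym0 !mulr0.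
have -> : \sum_i ('X_i * (el a)^`M(i)) * ('X_i * (el b.+1)^`M(i))
    = \sum_i ('X_i * (el a.+1)^`M(i)) * ('X_i * (el b)^`M(i))
      - el b * \sum_i ('X_i * (el a.+1)^`M(i))
      + el a * \sum_i ('X_i * (el b.+1)^`M(i)).
  rewrite !big_distrr -sumrB -big_split /=; apply: eq_bigr => i _.
  by rewrite !XdS; ring.
rewrite IHb !sum_euler_mesym addSnnS.
rewrite [in RHS]big_ltn; last by rewrite ltnS; lia.
have -> : (a + b.+1 - a.+1 = b)%N by lia.
set S := bigop _ _ _; rewrite natrD -!natr1; ring.
Qed.

Lemma mesym_cross_product_sym a b :
  \sum_i ('X_i * (el a)^`M(i)) * ('X_i * (el b)^`M(i))
  = (el a * el b) *+ minn a b
    - \sum_((maxn a b).+1 <= s < (a + b).+1)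
        (el s * el (a + b - s)) *+ (s.*2 - (a + b)).
Proof.
wlog le_ba : a b / (b <= a)%N => [IH|].
  have /orP[|le_ab] := leq_total b a; first exact: IH.
  under eq_bigr => i _ do rewrite mulrC.
  by rewrite IH // minnC maxnC addnC [el b * _]mulrC.
rewrite mesym_cross_product (maxn_idPl le_ba) (minn_idPr le_ba).
congr (_ - _); first by rewrite -mulrA mulr_natl.
apply: eq_big_nat => s /andP[lt_s le_s].
by rewrite -mulrnA muln2 -natrB ?mulr_natl //; lia.
Qed.

Definition min_sum m : nat := (\sum_i \sum_(j | j != i) minn (m i) (m j))%N.

Lemma mesym_prod_shift m i j s : j != i -> (s <= m i + m j)%N ->
  mesym_prod (shift m i j s)
  = el s * el (m i + m j - s) * \prod_(l | (l != i) && (l != j)) el (m l).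
Proof.
move=> ne_ji le_s; rewrite /mesym_prod (bigD1 i) //= (bigD1 j) //= mulrA.
rewrite !mnmE !eqxx (negPf ne_ji); congr (_ * _).
by apply: eq_bigr => l /andP[/negPf li /negPf lj]; rewrite mnmE li lj.
Qed.

(** The factors are multilinear, so a second derivative of the product must hit two
   different factors. *)
Lemma sum_mderiv2_mesym_prod m :
  \sum_i 'X_i ^+ 2 * ((mesym_prod m)^`M(i))^`M(i)
  = mesym_prod m *+ min_sum m - raising mesym_prod m.
Proof.
have d2E i : 'X_i ^+ 2 * ((mesym_prod m)^`M(i))^`M(i)
  = \sum_k \sum_(l | l != k) ('X_i * (el (m k))^`M(i)) * ('X_i * (el (m l))^`M(i))
      * \prod_(h | (h != k) && (h != l)) el (m h).
  rewrite mderiv_prod raddf_sum big_distrr /=; apply: eq_bigr => k _.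
  rewrite mderivM mderiv2_mesym mul0r add0r mderiv_prod 2!mulr_sumr /=.
  by apply: eq_bigr => l _; ring.
rewrite (eq_bigr _ (fun i _ => d2E i)) exchange_big /= /min_sum -sumrMnr -sumrB.
apply: eq_bigr => k _; rewrite exchange_big /= -sumrMnr -sumrB.
apply: eq_bigr => l ne_lk; rewrite -mulr_suml mesym_cross_product_sym mulrBl.
rewrite [(\sum_(_ <= _ < _) _) * _]mulr_suml mulrnAl; congr (_ *+ _ - _).
  by rewrite /mesym_prod [RHS](bigD1 k) //= [in RHS](bigD1 l) //= mulrA.
apply: eq_big_nat => s /andP[_ le_s].
by rewrite mulrnAl -mesym_prod_shift.
Qed.

Lemma min_max_sum m :
  (min_sum m + max_sum m + 2 * mdeg m = 2 * q * mdeg m)%N.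
Proof.
have -> : (2 * q * mdeg m = \sum_i \sum_j (m i + m j))%N.
  under eq_bigr => i _ do rewrite big_split sum_nat_const card_ord /= -mdegE.
  by rewrite big_split sum_nat_const card_ord /= -big_distrr /= -mdegE; lia.
rewrite [in (2 * mdeg m)%N]mdegE big_distrr -!big_split /=.
apply: eq_bigr => i _; rewrite [RHS](bigD1 i) //= addnC; congr addn; first lia.
by rewrite -big_split; apply: eq_bigr => j _; rewrite /= addn_min_max.
Qed.

(** The one-body part of the operator acts on a product of elementary symmetric
   polynomials by a scalar; the second derivatives raise the degrees of the factors
   with the weights that occur for monomials, but with the opposite sign. With the
   factor 2 the scalar is, up to a constant, minus twice the zonal eigenvalue. *)
Lemma beltrami_mesym_prod m :
  \sum_i 'X_i ^+ 2 * ((mesym_prod m)^`M(i))^`M(i)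
    + 2 *: \sum_i \sum_(j | j != i) mesym_prod_quotient m i j
  = (6 * (q%:R - 1) * (mdeg m)%:R
      - (2 * (falling_squares m)%:R + (max_sum m)%:R)) *: mesym_prod m
    - raising mesym_prod m.
Proof.
rewrite sum_mderiv2_mesym_prod sum_mesym_prod_quotient scalerA addrAC.
congr (_ - _); rewrite -scaler_nat -scalerDl; congr (_ *: _).
have /(congr1 (fun k => k%:R : R)) := min_max_sum m.
rewrite !natrD !natrM => eq_mm.
have -> : (min_sum m)%:R = 2 * q%:R * (mdeg m)%:R - 2 * (mdeg m)%:R - (max_sum m)%:R :> R.
  by rewrite -eq_mm; ring.
ring.
Qed.

Lemma mesym_prod_invariant : perm_invariant mesym_prod.
Proof.
move=> s m; rewrite /mesym_prod [RHS](reindex_inj (@perm_inj _ s)) /=.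
by apply: eq_bigr => i _; rewrite mnmE.
Qed.

Lemma mesym_prod_symmetric m : mesym_prod m \is symmetric.
Proof. by apply: rpred_prod => i _; exact: mesym_sym. Qed.

Lemma divided_difference_lin i j c f1 G1 f2 G2 :
  divided_difference i j f1 G1 -> divided_difference i j f2 G2 ->
  divided_difference i j (c *: f1 + f2) (c *: G1 + G2).
Proof.
rewrite /divided_difference => d1 d2.
rewrite mulrDr -scalerAr d1 d2 !mderivD !mderivZ -!mul_mpolyC; ring.
Qed.

Lemma divided_difference_mul i j f1 G1 f2 G2 :
  divided_difference i j f1 G1 -> divided_difference i j f2 G2 ->
  divided_difference i j (f1 * f2) (G1 * f2 + f1 * G2).
Proof.
rewrite /divided_difference => d1 d2.
by rewrite mulrDr mulrA d1 mulrCA d2 !mderivM; ring.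
Qed.

Lemma divided_difference0 i j : divided_difference i j (0 : {mpoly R[q]}) 0.
Proof. by rewrite /divided_difference !mderiv0 !mulr0 subrr. Qed.

Lemma divided_difference1 i j : divided_difference i j (1 : {mpoly R[q]}) 0.
Proof. by rewrite /divided_difference -mpolyC1 !mderivC !mulr0 subrr. Qed.

(** Divided differences exist on a subalgebra, which contains the elementary
   symmetric polynomials and hence all symmetric ones. *)
Lemma divided_difference_ex f i j : j != i -> f \is symmetric ->
  exists G, divided_difference i j f G.
Proof.
move=> ne_ji /sym_fundamental[t [<- _]].
elim/mpolyind: t => [|c m p _ _ [G dG]].
  by exists 0; rewrite comp_mpoly0; exact: divided_difference0.
rewrite comp_mpolyD comp_mpolyZ comp_mpolyX.
suff [G' dG'] : exists G', divided_difference i j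
    (\prod_(k < q) tnth [tuple el k'.+1 | k' < q] k ^+ m k) G'.
  by exists (c *: G' + G); exact: divided_difference_lin.
elim/big_ind: _ => [|f1 f2 [G1 d1] [G2 d2]|k _].
- by exists 0; exact: divided_difference1.
- by exists (G1 * f2 + f1 * G2); exact: divided_difference_mul.
rewrite tnth_mktuple; elim: (m k) => [|e [G' dG']].
  by exists 0; rewrite expr0; exact: divided_difference1.
exists (mesym_quotient i j k.+1 * el k.+1 ^+ e + el k.+1 * G').
by rewrite exprS; apply: divided_difference_mul => //; exact: mesym_quotientP.
Qed.

End Elementary.

(** * Partitions as exponent vectors *)

Section Partitions.
Variables (n q : nat).
Hypothesis le_nq : (n <= q)%N.
Implicit Types (lam kap : intpartn n) (m : 'X_{1..q}).

Definition exponent lam : 'X_{1..q} := [multinom part lam i | i < q].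

Lemma size_parts lam : (size (parts lam) <= q)%N.
Proof. by rewrite size_map (leq_trans _ le_nq) // size_bseq. Qed.

Lemma part_default lam i : (size (parts lam) <= i)%N -> part lam i = 0%N.
Proof. exact: nth_default. Qed.

Lemma part_out lam i : (q <= i)%N -> part lam i = 0%N.
Proof. by move=> le_qi; apply/part_default/(leq_trans (size_parts lam)). Qed.

Lemma leq_part lam i j : (i <= j)%N -> (part lam j <= part lam i)%N.
Proof.
move=> le_ij; have [lt_j|le_j] := ltnP j (size (parts lam)); last first.
  by rewrite part_default.
have /and3P[sorted_lam _ _] := parts_is_partition lam.
have geq_trans : transitive geq by move=> a b c ab bc; exact: leq_trans bc ab.
have geq_refl : reflexive geq by move=> a; exact: leqnn.
apply: (sorted_leq_nth geq_trans geq_refl 0%N sorted_lam) => //.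
by rewrite inE (leq_ltn_trans le_ij).
Qed.

Lemma part_inj lam kap : (forall i, part lam i = part kap i) -> lam = kap.
Proof.
move=> eq_part; apply: parts_inj.
have size_le lam' kap' : (forall i, part lam' i = part kap' i) ->
    (size (parts lam') <= size (parts kap'))%N.
  move=> eq_p; rewrite leqNgt; apply/negP => lt_s.
  have /and3P[_ /negP[]] := parts_is_partition lam'.
  by rewrite -(nth_default 0%N (leqnn (size (parts kap')))) -/(part kap' _) -eq_p mem_nth.
apply: (@eq_from_nth _ 0%N) => [|i _]; last exact: eq_part.
by apply/eqP; rewrite eqn_leq !size_le.
Qed.

Lemma leq_sum_support (F : nat -> nat) p r : (forall i, (r <= i)%N -> F i = 0%N) ->
  (\sum_(i < p) F i <= \sum_(i < r) F i)%N.
Proof.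
move=> F0; rewrite -!(big_mkord xpredT); have [le_pr|/ltnW le_rp] := leqP p r.
  by rewrite [leqRHS](big_cat_nat (n := p)) //= leq_addr.
rewrite (big_cat_nat (n := r)) //= -[leqRHS]addn0 leq_add2l big_nat_cond big1 //.
by move=> i /andP[/andP[/F0]].
Qed.

Lemma sum_parts (F : nat -> nat) lam : F 0%N = 0%N ->
  (\sum_(i < q) F (part lam i) = \sum_(x <- parts lam) F x)%N.
Proof.
move=> F0; rewrite (big_nth 0%N) big_mkord; apply/eqP.
rewrite eqn_leq !(leq_sum_support (F := fun i => F (part lam i))) // => i le_i.
- by rewrite part_out.
- by rewrite part_default.
Qed.

Lemma mdeg_exponent lam : mdeg (exponent lam) = n.
Proof.
have /and3P[_ _ /eqP sum_lam] := parts_is_partition lam.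
rewrite -[RHS]sum_lam sumnE -(sum_parts (F := id)) // mdegE.
by apply: eq_bigr => i _; rewrite mnmE.
Qed.

Lemma excess_exponent k lam :
  excess k (exponent lam) = (\sum_(i < q) (part lam i - k))%N.
Proof. by apply: eq_bigr => i _; rewrite mnmE. Qed.

Lemma partial_sum_le k lam p :
  (\sum_(i < p) part lam i <= p * k + excess k (exponent lam))%N.
Proof.
apply: (@leq_trans (p * k + \sum_(i < p) (part lam i - k))%N).
  have -> : (p * k = \sum_(i < p) k)%N by rewrite sum_nat_const card_ord.
  rewrite -big_split /=.
  by apply: leq_sum => i _; lia.
rewrite leq_add2l excess_exponent.
by apply: (leq_sum_support (F := fun i => (part lam i - k)%N)) => i /part_out ->.
Qed.

Lemma partial_sum_ge k lam p : (part lam p <= k)%N ->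
  (forall i, (i < p)%N -> (k <= part lam i)%N) ->
  (p * k + excess k (exponent lam) <= \sum_(i < p) part lam i)%N.
Proof.
move=> le_pk ge_k.
apply: (@leq_trans (p * k + \sum_(i < p) (part lam i - k))%N).
  rewrite leq_add2l excess_exponent.
  apply: (leq_sum_support (F := fun i => (part lam i - k)%N)) => i le_pi.
  by apply/eqP; rewrite subn_eq0 (leq_trans (leq_part lam le_pi)).
have -> : (p * k = \sum_(i < p) k)%N by rewrite sum_nat_const card_ord.
rewrite -big_split /=.
by apply: leq_sum => i _; rewrite subnKC // ge_k.
Qed.

(** Partial sums and excesses are Legendre transforms of each other:
   a partial sum of length [p] is the minimum over [k] of [p * k + excess k]. *)
Lemma dominatedP lam kap : dominated (exponent lam) (exponent kap) <->
  forall p, (\sum_(i < p) part lam i <= \sum_(i < p) part kap i)%N.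
Proof.
split=> [dom p | le_sum k].
  apply: leq_trans (partial_sum_le (part kap p) lam p) _.
  apply: (@leq_trans (p * part kap p + excess (part kap p) (exponent kap))%N).
    by rewrite leq_add2l.
  by apply: partial_sum_ge => // i /ltnW; exact: leq_part.
have ex_p : exists p, (part lam p <= k)%N by exists q; rewrite part_out.
have [p le_pk p_min] := ex_minnP ex_p.
rewrite -(leq_add2l (p * k)); apply: leq_trans (partial_sum_le k kap p).
apply: leq_trans (le_sum p); apply: partial_sum_ge => // i lt_ip.
rewrite leqNgt; apply/negP => lt_k.
by have := p_min i (ltnW lt_k); rewrite leqNgt lt_ip.
Qed.

Lemma dominated_anti lam kap :
  dominated (exponent lam) (exponent kap) ->
  dominated (exponent kap) (exponent lam) -> lam = kap.
Proof.
move=> /dominatedP le_lk /dominatedP le_kl; apply: part_inj => i.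
have sumE p : (\sum_(i < p) part lam i = \sum_(i < p) part kap i)%N.
  by apply/eqP; rewrite eqn_leq le_lk le_kl.
by have := sumE i.+1; rewrite !big_ord_recr /= sumE => /addnI.
Qed.

Lemma exponent_ex m : mdeg m = n -> exists lam, exists s : 'S_q,
  m = [multinom exponent lam (s i) | i < q].
Proof.
move=> deg_m; pose t := sort geq [seq x <- (m : seq nat) | x != 0%N].
have sumE (F : nat -> nat) : F 0%N = 0%N ->
    (\sum_(x <- t) F x = \sum_(x <- (m : seq nat)) F x)%N.
  move=> F0; rewrite (perm_big _ (introT permPl (perm_sort _ _))) big_filter.
  by rewrite [RHS](bigID (fun x => x != 0%N)) /= [X in (_ + X)%N]big1 ?addn0 //
     => x /negPn /eqP ->.
have tP : is_partition n t.
  apply/and3P; split.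
  - by apply: sort_sorted => x y; exact: leq_total.
  - by rewrite mem_sort mem_filter eqxx.
  - by rewrite sumnE (sumE id) // -deg_m.
have [lam lamE] := intpartnP tP; exists lam; apply: excess_inj_perm => k.
rewrite excess_exponent (sum_parts (F := fun x => x - k)%N) ?sub0n // lamE.
rewrite (sumE (fun x => x - k)%N) ?sub0n // big_tuple.
by apply: eq_bigr.
Qed.

Lemma excess_perm k m (s : 'S_q) :
  excess k [multinom m (s i) | i < q] = excess k m.
Proof.
rewrite /excess [RHS](reindex_inj (@perm_inj _ s)) /=.
by apply: eq_bigr => i _; rewrite mnmE.
Qed.

Lemma exponent_inj lam kap (s : 'S_q) :
  exponent kap = [multinom exponent lam (s i) | i < q] -> kap = lam.
Proof.
move=> eq_m; have eq_ex k : excess k (exponent kap) = excess k (exponent lam).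
  by rewrite eq_m excess_perm.
by apply: dominated_anti => k; rewrite eq_ex.
Qed.

Lemma max_sum_exponent lam :
  max_sum (exponent lam) = (2 * \sum_(i < q) (q - i.+1) * part lam i)%N.
Proof.
have rowE (i : 'I_q) : (\sum_(j < q | i < j) part lam i = (q - i.+1) * part lam i)%N.
  by rewrite -(big_geq_mkord i.+1 q xpredT (fun=> part lam i)) sum_nat_const_nat.
rewrite mul2n -addnn /max_sum.
have -> : (\sum_i \sum_(j | j != i) maxn (exponent lam i) (exponent lam j)
  = \sum_(i < q) \sum_(j < q | i < j) part lam i
    + \sum_(i < q) \sum_(j < q | j < i) part lam j)%N.
  rewrite -big_split /=; apply: eq_bigr => i _.
  rewrite (bigID (fun j : 'I_q => i < j)%N) /=.
  congr addn.
    apply: eq_big => [j|j /andP[_ lt_ij]].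
      by rewrite -val_eqE /=; case: ltngtP.
    by rewrite !mnmE; apply/maxn_idPl/leq_part/ltnW.
  apply: eq_big => [j|j /andP[_]].
    by rewrite -val_eqE /=; case: ltngtP.
  by rewrite -leqNgt => le_ji; rewrite !mnmE; apply/maxn_idPr/leq_part.
congr addn; first by apply: eq_bigr.
by rewrite (exchange_big_dep xpredT) //=; apply: eq_bigr.
Qed.

Lemma rho_eigenvalue (R : realFieldType) lam :
  (falling_squares (exponent lam))%:R + 2^-1 * (max_sum (exponent lam))%:R
  = (rho lam)%:~R + (q%:R - 1) * n%:R :> R.
Proof.
have -> : rho lam = \sum_(i < q) (part lam i)%:Z * ((part lam i)%:Z - (i.+1)%:Z).
  rewrite /rho.
  rewrite -(big_mkord xpredT (fun i => (part lam i)%:Z * ((part lam i)%:Z - i.+1%:Z))).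
  rewrite -(big_mkord xpredT (fun i => (part lam i)%:Z * ((part lam i)%:Z - i.+1%:Z))).
  rewrite [RHS](big_cat_nat (n := size (parts lam))) ?size_parts //=.
  rewrite [X in _ = _ + X]big_nat_cond [X in _ = _ + X]big1 ?addr0 //.
  by move=> i /andP[/andP[/part_default -> _] _]; rewrite mul0r.
have -> : n%:R = \sum_(i < q) (part lam i)%:R :> R.
  rewrite -natr_sum; congr _%:R; rewrite -[LHS](mdeg_exponent lam) mdegE.
  by apply: eq_bigr => i _; rewrite mnmE.
rewrite max_sum_exponent natrM mulrA mulVf ?mul1r ?pnatr_eq0 //.
rewrite /falling_squares [X in _ = X + _]rmorph_sum big_distrr !natr_sum.
rewrite -!big_split /=; apply: eq_bigr => i _.
rewrite mnmE intrM intrB -!pmulrn !natrM natrB // -!natr1.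
case: (part lam i) => [|x]; first by rewrite !mul0r !mulr0.
by rewrite -[x.+1.-1]/x -natr1; ring.
Qed.

End Partitions.

(** * Monomials of products of elementary symmetric polynomials *)

Section ElementaryProducts.
Variables (R : realFieldType) (q : nat).
Implicit Types (m : 'X_{1..q}) (p : {mpoly R[q]}).
Local Notation el k := (mesym q R k).

Lemma mcoeffM_neq0 p1 p2 m : (p1 * p2)@_m != 0 ->
  exists m1 m2, [/\ m = (m1 + m2)%MM, p1@_m1 != 0 & p2@_m2 != 0].
Proof.
rewrite -mcoeff_msupp => /msuppM_le /allpairsP[[m1 m2] /= [in1 in2 ->]].
by exists m1, m2; rewrite -!mcoeff_msupp.
Qed.

Definition coeff_nonneg p := forall m, 0 <= p@_m.

Lemma coeff_nonnegM p1 p2 :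
  coeff_nonneg p1 -> coeff_nonneg p2 -> coeff_nonneg (p1 * p2).
Proof.
move=> p1_ge0 p2_ge0 m; rewrite mcoeffM sumr_ge0 // => k _.
by rewrite mulr_ge0.
Qed.

Lemma coeff_posM p1 p2 m1 m2 : coeff_nonneg p1 -> coeff_nonneg p2 ->
  0 < p1@_m1 -> 0 < p2@_m2 -> 0 < (p1 * p2)@_(m1 + m2).
Proof.
move=> p1_ge0 p2_ge0 pos1 pos2; pose p1' := p1 - p1@_m1 *: 'X_[m1].
have p1'_ge0 : coeff_nonneg p1'.
  move=> m; rewrite mcoeffB mcoeffZ mcoeffX.
  by case: eqP => [->|_]; rewrite ?mulr1 ?subrr // mulr0 subr0.
have -> : p1 = p1@_m1 *: 'X_[m1] + p1' by rewrite addrC subrK.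
rewrite mulrDl mcoeffD -scalerAl mcoeffZ ['X_[m1] * _]mulrC.
rewrite ltr_wpDr ?(coeff_nonnegM p1'_ge0) //.
by rewrite mcoeffMX mulr_gt0.
Qed.

Lemma mesym_nonneg k : coeff_nonneg (el k).
Proof. by move=> m; rewrite mcoeff_mesym ler0n. Qed.

(** A monomial of the product is a sum of 0-1 vectors, one for each factor. The first
   [k] of them contribute at most [k] to each exponent, so whatever exceeds [k] comes
   from the other factors, whose total degree is the right-hand side. *)
Lemma mesym_prod_support m m' : (mesym_prod R m)@_m' != 0 ->
  mdeg m' = mdeg m /\
  forall k, (excess k m' <= \sum_(i < q | k <= i) m i)%N.
Proof.
pose w k (r : seq 'I_q) := count (fun i : 'I_q => i < k)%N r.
have supp (r : seq 'I_q) : forall m', (\prod_(i <- r) el (m i))@_m' != 0 ->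
    mdeg m' = (\sum_(i <- r) m i)%N /\ forall k,
    (\sum_i (m' i - w k r) <= \sum_(i <- r | k <= i) m i)%N.
  elim: r => [|i r IHr] {}m'.
    rewrite big_nil mcoeff1; case: (m' =P 0%MM) => [-> _|_]; last by rewrite eqxx.
    by rewrite mdeg0 big_nil; split=> // k; rewrite big1 // => j _; rewrite mnm0E.
  rewrite big_cons => /mcoeffM_neq0[u [m'' [-> ]]].
  rewrite mcoeff_mesym pnatr_eq0 eqb0 negbK => /andP[/eqP deg_u /forallP le1].
  move=> /IHr[deg_m'' le_m'']; split=> [|k].
    by rewrite mdegD deg_u deg_m'' big_cons.
  rewrite big_cons /w /= -/(w k r); have := le_m'' k; case: (ltnP i k) => _ le_k /=.
    apply: leq_trans le_k; apply: leq_sum => j _; rewrite mnmDE.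
    by have := le1 j; lia.
  rewrite -deg_u mdegE; apply: leq_trans (leq_add (leqnn _) le_k).
  by rewrite -big_split /=; apply: leq_sum => j _; rewrite mnmDE; lia.
move=> /supp[-> le_k]; split=> [|k]; first by rewrite mdegE.
apply: leq_trans (le_k k); apply: leq_sum => i _; apply: leq_sub2l.
rewrite /w -sum1_count big_mkcond /=.
apply: leq_trans (@leq_sum_support (fun l => if (l < k)%N then 1%N else 0%N) q k _) _.
  by move=> l; rewrite leqNgt => /negPf ->.
rewrite -[leqRHS]card_ord -sum1_card; apply: leq_sum => l _.
by case: ifP.
Qed.

Definition first_ones k : 'X_{1..q} := [multinom ((i < k)%N : nat) | i < q].

Lemma mdeg_first_ones k : (k <= q)%N -> mdeg (first_ones k) = k.
Proof.
move=> le_kq; rewrite mdegE; under eq_bigr => i _ do rewrite mnmE.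
have -> : (\sum_(i < q) ((i < k)%N : nat) = \sum_(i < q | (i < k)%N) 1)%N.
  by rewrite [RHS]big_mkcond; apply: eq_bigr => i _; case: (i < k)%N.
by rewrite -(big_ord_widen q (fun=> 1%N) le_kq) sum_nat_const card_ord muln1.
Qed.

(** Both sides count the ways to distribute [k] labels over boxes of sizes [m i]:
   removing the last label gives the same recursion for them. *)
Lemma mcoeff_first_ones_mesym_prod k m : (k <= q)%N -> mdeg m = k ->
  (mesym_prod R m)@_(first_ones k) = ((\sum_i 'X_i) ^+ k : {mpoly R[q]})@_m.
Proof.
elim: k m => [|k IHk] m.
  move=> _ /eqP; rewrite mdeg_eq0 => /eqP ->; rewrite expr0 mcoeff1 eqxx.
  rewrite /mesym_prod big1 => [|i _]; last by rewrite mnm0E mesym0E.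
  by rewrite mcoeff1; case: eqP => // -[]; apply/mnmP => i; rewrite !mnmE.
move=> lt_kq deg_m; pose x := Ordinal lt_kq.
have x0 : first_ones k x = 0%N by rewrite mnmE ltnn.
have -> : first_ones k.+1 = (first_ones k + U_(x))%MM.
  apply/mnmP => i; rewrite mnmDE mnm1E !mnmE ltnS -val_eqE /= leq_eqVlt eq_sym.
  by case: ltngtP.
have := mcoeff_deriv x (first_ones k) (mesym_prod R m); rewrite x0 mulr1n => <-.
rewrite {1}/mesym_prod mderiv_prod exprS mulr_suml.
rewrite [LHS]raddf_sum [RHS]raddf_sum /=.
apply: eq_bigr => i _; rewrite mcoeffXM; case: eqP => [->|/eqP mi].
  by rewrite mderiv_mesym0 mul0r mcoeff0.
have mi1 : (m i = (m i).-1.+1)%N by rewrite prednK ?lt0n.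
rewrite mi1 mderiv_mesymS mulrBl mcoeffB -mulrA mcoeffXM x0 eqxx subr0.
rewrite -IHk; first last.
- by have := mdegD (m - U_(i)) U_(i); rewrite submK ?lep1mP // deg_m mdeg1; lia.
- exact: ltnW.
congr _@__; rewrite /mesym_prod [RHS](bigD1 i) //= mnmBE mnm1E eqxx subn1.
congr (_ * _); apply: eq_bigr => l ne_li.
by rewrite mnmBE mnm1E eq_sym (negPf ne_li) subn0.
Qed.

End ElementaryProducts.

(** * The triangular system and its dual eigenvectors *)

Lemma sum_neq0 (V : nmodType) (I : eqType) (r : seq I) (P : pred I) (F : I -> V) :
  \sum_(i <- r | P i) F i != 0 -> exists i, [/\ i \in r, P i & F i != 0].
Proof.
elim: r => [|i r IHr]; first by rewrite big_nil eqxx.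
rewrite big_cons; case: ifP => [Pi|_].
  have [Fi0|Fi _] := eqVneq (F i) 0; last by exists i; rewrite mem_head.
  by rewrite Fi0 add0r => /IHr[k [k_r Pk Fk]]; exists k; rewrite inE k_r orbT.
by move=> /IHr[k [k_r Pk Fk]]; exists k; rewrite inE k_r orbT.
Qed.

Section RaisingMatrix.
Variables (n q : nat).
Hypothesis le_nq : (n <= q)%N.
Implicit Types lam mu kap : intpartn n.
Local Notation ex := (@exponent n q).

Definition of_shape lam (m : 'X_{1..q}) :=
  [exists s : 'S_q, m == [multinom ex lam (s i) | i < q]].

(** The matrix of [raising] on symmetric functions, restricted to partitions. The same
   matrix governs monomials (acting on rows) and products of elementary symmetric
   polynomials (acting on columns). *)
Definition raise_coeff mu lam : nat :=
  (\sum_i \sum_(j | j != i)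
    \sum_((maxn (ex lam i) (ex lam j)).+1 <= s < (ex lam i + ex lam j).+1)
      of_shape mu (shift (ex lam) i j s) * (s.*2 - (ex lam i + ex lam j)))%N.

Lemma of_shape_expand (V : zmodType) (g : 'X_{1..q} -> V) m :
  perm_invariant g -> mdeg m = n ->
  g m = \sum_mu g (ex mu) *+ of_shape mu m.
Proof.
move=> sym_g deg_m; have [lam [s def_m]] := exponent_ex le_nq deg_m.
rewrite (bigD1 lam) //= big1 => [|mu ne_mu].
  rewrite addr0 (_ : of_shape lam m) ?mulr1n ?def_m ?sym_g //.
  by apply/existsP; exists s.
case: (boolP (of_shape mu m)) => [/existsP[t /eqP def_m']|_]; last by rewrite mulr0n.
case/eqP: ne_mu; apply: (@exponent_inj n q le_nq lam mu (t^-1 * s)%g).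
apply/mnmP => i; rewrite mnmE permM.
have /mnmP/(_ (t^-1%g i)) := etrans (esym def_m') def_m.
by rewrite !mnmE permKV.
Qed.

Lemma raising_expand (V : zmodType) (g : 'X_{1..q} -> V) lam :
  perm_invariant g -> raising g (ex lam) = \sum_mu g (ex mu) *+ raise_coeff mu lam.
Proof.
move=> sym_g; rewrite /raising /raise_coeff.
under [RHS]eq_bigr => mu _ do rewrite -sumrMnr.
rewrite exchange_big /=; apply: eq_bigr => i _.
under [RHS]eq_bigr => mu _ do rewrite -sumrMnr.
rewrite exchange_big /=; apply: eq_bigr => j ne_ji.
under [RHS]eq_bigr => mu _ do rewrite -sumrMnr.
rewrite exchange_big /=; apply: eq_big_nat => s /andP[_ le_s].
rewrite (of_shape_expand sym_g); last first.
  by rewrite mdeg_shift ?(eq_sym i) // mdeg_exponent.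
by rewrite -sumrMnl; apply: eq_bigr => mu _; rewrite mulrnA.
Qed.

Lemma raise_coeff_neq0 mu lam : raise_coeff mu lam != 0%N ->
  dominated (ex lam) (ex mu) /\ (falling_squares (ex lam) < falling_squares (ex mu))%N.
Proof.
move=> /(@sum_neq0 nat)[i [_ _ /(@sum_neq0 nat)[j [_ ne_ji /(@sum_neq0 nat)[s []]]]]].
rewrite mem_index_iota ltnS => hs _ shape_mu.
have ne_ij : i != j by rewrite eq_sym.
have /existsP[t /eqP def_m] : of_shape mu (shift (ex lam) i j s).
  by apply: contraNT shape_mu => /negPf ->.
have ex_mu k : excess k (ex mu) = excess k (shift (ex lam) i j s).
  by rewrite def_m excess_perm.
have dom : dominated (ex lam) (ex mu).
  by move=> k; rewrite ex_mu; exact: dominated_shift.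
split=> //; apply: (ltn_falling_squares _ dom).
  by rewrite !mdeg_exponent.
by rewrite ex_mu; exact: excess_shift_lt.
Qed.

(** Twice the eigenvalue of the zonal operator, which makes it a natural number. *)
Definition double_eigenvalue lam : nat :=
  (2 * falling_squares (ex lam) + max_sum (ex lam))%N.

(** Different partitions may share an eigenvalue, but comparable ones do not. *)
Lemma double_eigenvalue_inj lam mu : dominated (ex lam) (ex mu) ->
  double_eigenvalue lam = double_eigenvalue mu -> lam = mu.
Proof.
move=> dom eq_ev; have deg_eq : mdeg (ex lam) = mdeg (ex mu) by rewrite !mdeg_exponent.
have le_ms := leq_max_sum deg_eq dom.
apply: (@dominated_anti n q) => // k; rewrite leqNgt; apply/negP => lt_k.
have := ltn_falling_squares deg_eq dom lt_k.
by move: eq_ev; rewrite /double_eigenvalue; lia.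
Qed.

Lemma double_eigenvalue_lt lam mu : raise_coeff mu lam != 0%N ->
  (double_eigenvalue lam < double_eigenvalue mu)%N.
Proof.
move=> /raise_coeff_neq0[dom lt_fs].
have := leq_max_sum _ dom; rewrite !mdeg_exponent // => /(_ erefl).
by rewrite /double_eigenvalue; lia.
Qed.

End RaisingMatrix.

(** Well-founded recursion along a rank on a finite type, by iteration. *)
Lemma rank_fixpoint (T : finType) (A : Type) (a0 : A) (h : T -> nat)
    (Phi : (T -> A) -> T -> A) :
  (forall f g x, (forall y, (h y < h x)%N -> f y = g y) -> Phi f x = Phi g x) ->
  exists f, forall x, f x = Phi f x.
Proof.
move=> Phi_rank; pose it k := iter k Phi (fun=> a0).
have stable k : forall x, (h x < k)%N -> it k x = it k.+1 x.
  elim: k => // k IHk x; rewrite ltnS => le_x; apply: Phi_rank => y lt_yx.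
  exact/IHk/(leq_trans lt_yx).
exists (it (\max_x h x).+1) => x; rewrite [LHS]stable // ltnS.
exact: leq_bigmax.
Qed.

Section DualVector.
Variables (R : realFieldType) (n q : nat).
Hypothesis le_nq : (n <= q)%N.
Implicit Types lam mu kap : intpartn n.
Local Notation ex := (@exponent n q).
Local Notation rc := (@raise_coeff n q).
Local Notation ev := (@double_eigenvalue n q).

(** The transpose of the triangular system for the coefficients has an eigenvector
   supported above [kap]. *)
Lemma dual_vector kap : exists v : intpartn n -> R,
  [/\ v kap = 1, forall mu, v mu != 0 -> dominated (ex kap) (ex mu)
    & forall mu, (ev mu)%:R * v mu + \sum_lam (rc mu lam)%:R * v lam
                 = (ev kap)%:R * v mu].
Proof.
pose Phi (v : intpartn n -> R) mu := if mu == kap then 1 else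
  if ev mu == ev kap then 0 else
  (\sum_lam (rc mu lam)%:R * v lam) / ((ev kap)%:R - (ev mu)%:R).
have [f g mu eq_fg|v vE] := @rank_fixpoint _ _ 0 ev Phi.
  rewrite /Phi; do 2! case: eqP => // _; congr (_ / _).
  apply: eq_bigr => lam _; have [->|/(double_eigenvalue_lt le_nq) lt_ev] :=
    eqVneq (rc mu lam) 0%N; first by rewrite !mul0r.
  by rewrite eq_fg.
have supp mu : v mu != 0 -> dominated (ex kap) (ex mu).
  have [k] := ubnP (ev mu); elim: k mu => // k IHk mu le_k.
  rewrite vE /Phi; case: (mu =P kap) => [-> _|_]; first exact: dominated_refl.
  case: (ev mu =P ev kap) => [_|_]; first by rewrite eqxx.
  rewrite mulf_eq0 negb_or => /andP[/sum_neq0[lam [_ _ +]] _] /=.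
  rewrite mulf_eq0 negb_or pnatr_eq0 => /andP[rc_neq0 v_lam].
  have lt_ev := double_eigenvalue_lt le_nq rc_neq0.
  have [dom _] := raise_coeff_neq0 le_nq rc_neq0.
  by apply: dominated_trans dom; apply: IHk => //; exact: leq_trans lt_ev le_k.
exists v; split=> //; first by rewrite vE /Phi eqxx.
(* If [lam] dominates [kap] and can be raised to [mu], then [mu] has a larger
   eigenvalue than [kap]; hence where the eigenvalues agree nothing is raised. *)
have sum0 mu : ev mu = ev kap -> \sum_lam (rc mu lam)%:R * v lam = 0.
  move=> eq_ev; apply: big1 => lam _; apply/eqP; rewrite mulf_eq0 pnatr_eq0.
  apply: contra_eqT eq_ev; rewrite negb_or => /andP[rc_neq0 /supp dom].
  have lt_ev := double_eigenvalue_lt le_nq rc_neq0.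
  have deg_eq : mdeg (ex kap) = mdeg (ex lam) by rewrite !mdeg_exponent.
  have := leq_falling_squares deg_eq dom; have := leq_max_sum deg_eq dom.
  by move: lt_ev; rewrite /double_eigenvalue; lia.
move=> mu; have [eq_ev|ne_ev] := eqVneq (ev mu) (ev kap).
  by rewrite sum0 // addr0 eq_ev.
rewrite [v mu]vE /Phi (negPf ne_ev) ifN; last by apply: contraNneq ne_ev => ->.
set S := \sum_lam _.
have gap : (ev kap)%:R - (ev mu)%:R != 0 :> R.
  by rewrite subr_eq0 eqr_nat eq_sym.
by field.
Qed.

End DualVector.

(** * The dual polynomial *)

Section DualPolynomial.
Variables (R : realFieldType) (n q : nat).
Hypothesis le_nq : (n <= q)%N.
Implicit Types lam mu kap : intpartn n.
Local Notation ex := (@exponent n q).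
Local Notation rc := (@raise_coeff n q).
Local Notation ev := (@double_eigenvalue n q).

Definition dual_poly (v : intpartn n -> R) : {mpoly R[q]} :=
  \sum_lam v lam *: mesym_prod R (ex lam).

Lemma dual_poly_symmetric v : dual_poly v \is symmetric.
Proof. by apply: rpred_sum => lam _; rewrite rpredZ ?mesym_prod_symmetric. Qed.

Lemma mcoeff_dual_poly v m :
  (dual_poly v)@_m = \sum_lam v lam * (mesym_prod R (ex lam))@_m.
Proof. by rewrite raddf_sum; apply: eq_bigr => lam _; rewrite /= mcoeffZ. Qed.

(** Raising the factors transposes into the column system solved by [v], and the scalar
   part of [beltrami_mesym_prod] cancels the dependence on the index. *)
Lemma dual_poly_eigenfunction v kap :
  (forall mu, (ev mu)%:R * v mu + \sum_lam (rc mu lam)%:R * v lam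
              = (ev kap)%:R * v mu) ->
  eigenfunction 2 (6 * (q%:R - 1) * n%:R - (ev kap)%:R)
    (fun m => (dual_poly v)@_m).
Proof.
move=> eq_v; pose G i j := \sum_lam v lam *: mesym_prod_quotient R (ex lam) i j.
apply: (@eigenfunction_mcoeff _ _ _ _ _ G); first exact: dual_poly_symmetric.
  move=> i j ne_ji; apply: (big_ind2 (divided_difference i j)).
  - exact: divided_difference0.
  - move=> f1 g1 f2 g2 d1 d2; rewrite -[f1]scale1r -[g1]scale1r.
    exact: divided_difference_lin.
  - move=> lam _; rewrite -[_ *: _]addr0 -[X in divided_difference _ _ _ X]addr0.
    apply: divided_difference_lin; last exact: divided_difference0.
    exact: mesym_prod_quotientP.
have derivE (w : intpartn n -> {mpoly R[q]}) i :
    (\sum_lam v lam *: w lam)^`M(i) = \sum_lam v lam *: (w lam)^`M(i).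
  by rewrite linear_sum; apply: eq_bigr => lam _; rewrite /= mderivZ.
have -> : \sum_i 'X_i ^+ 2 * ((dual_poly v)^`M(i))^`M(i)
    + 2 *: \sum_i \sum_(j | j != i) G i j
  = \sum_lam v lam *: (\sum_i 'X_i ^+ 2 * ((mesym_prod R (ex lam))^`M(i))^`M(i)
      + 2 *: \sum_i \sum_(j | j != i) mesym_prod_quotient R (ex lam) i j).
  under [RHS]eq_bigr => lam _ do rewrite scalerDr scalerA mulrC -scalerA.
  rewrite [RHS]big_split -scaler_sumr /=; congr (_ + _ *: _).
    under [RHS]eq_bigr => lam _ do rewrite scaler_sumr.
    rewrite [RHS]exchange_big /=; apply: eq_bigr => i _.
    rewrite /dual_poly !derivE mulr_sumr; apply: eq_bigr => lam _.
    by rewrite scalerAr.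
  under [RHS]eq_bigr => lam _ do rewrite scaler_sumr.
  rewrite [RHS]exchange_big /=; apply: eq_bigr => i _.
  under [RHS]eq_bigr => lam _ do rewrite scaler_sumr.
  by rewrite [RHS]exchange_big.
under eq_bigr => lam _.
  rewrite beltrami_mesym_prod mdeg_exponent // scalerBr scalerA.
  rewrite (raising_expand le_nq lam (@mesym_prod_invariant R q)) scaler_sumr.
  over.
rewrite sumrB exchange_big /= -sumrB /dual_poly scaler_sumr.
apply: eq_bigr => mu _; rewrite scalerA.
have -> : \sum_lam v lam *: (mesym_prod R (ex mu) *+ rc mu lam)
    = (\sum_lam (rc mu lam)%:R * v lam) *: mesym_prod R (ex mu).
  rewrite scaler_suml; apply: eq_bigr => lam _.
  by rewrite -scaler_nat scalerA mulrC.
rewrite -scalerBl; congr (_ *: _); have := eq_v mu.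
rewrite /double_eigenvalue natrD natrM; set S := bigop _ _ _ => eqS.
have -> : S = (2 * (falling_squares (ex kap))%:R + (max_sum (ex kap))%:R) * v mu
  - (2 * (falling_squares (ex mu))%:R + (max_sum (ex mu))%:R) * v mu.
  by move: eqS; rewrite natrD natrM => <-; ring.
by rewrite natrD natrM; ring.
Qed.

Definition conjugate lam : 'X_{1..q} :=
  [multinom (\sum_(r < q) (i < part lam r))%N | i < q].

Lemma partial_sum_tail lam k :
  (\sum_(i < k) part lam i + \sum_(i < q | k <= i) part lam i = n)%N.
Proof.
rewrite -[RHS](mdeg_exponent le_nq lam) mdegE.
rewrite [RHS](bigID (fun i : 'I_q => i < k)%N) /=; congr addn; last first.
  by apply: eq_big => [i|i _]; rewrite ?mnmE // -leqNgt.
under [RHS]eq_bigr => i _ do rewrite mnmE.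
rewrite [RHS](big_mkcond (fun i : 'I_q => i < k)%N) /=.
pose F i := if (i < k)%N then part lam i else 0%N.
rewrite (eq_bigr (fun i : 'I_k => F i)); last by move=> i _; rewrite /F ltn_ord.
apply/eqP; rewrite eqn_leq !(leq_sum_support (F := F)) // => i; rewrite /F.
- by rewrite leqNgt => /negPf ->.
- by move=> /(part_out le_nq lam) ->; case: ifP.
Qed.

Lemma tail_antitone kap lam k : dominated (ex kap) (ex lam) ->
  (\sum_(i < q | k <= i) part lam i <= \sum_(i < q | k <= i) part kap i)%N.
Proof.
move=> /(dominatedP le_nq)/(_ k).
have := partial_sum_tail kap k; have := partial_sum_tail lam k.
set a := bigop _ _ _; set b := bigop _ _ _; set c := bigop _ _ _.
set d := bigop _ _ _; lia.
Qed.

Lemma dominated_tail kap lam :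
  (forall k, (\sum_(i < q | k <= i) part kap i
              <= \sum_(i < q | k <= i) part lam i)%N) ->
  dominated (ex lam) (ex kap).
Proof.
move=> le_tail; apply/(dominatedP le_nq) => k; have := le_tail k.
have := partial_sum_tail kap k; have := partial_sum_tail lam k.
set a := bigop _ _ _; set b := bigop _ _ _; set c := bigop _ _ _.
set d := bigop _ _ _; lia.
Qed.

Lemma mdeg_column lam (r : 'I_q) :
  mdeg [multinom ((i < part lam r)%N : nat) | i < q] = part lam r.
Proof.
apply: mdeg_first_ones; have -> : part lam r = ex lam r by rewrite mnmE.
apply: leq_trans le_nq; rewrite -[leqRHS](mdeg_exponent le_nq lam) mdegE.
by rewrite (bigD1 r) //= leq_addr.
Qed.

(** In each column, the boxes below row [k] are those beyond the first [k] boxes. *)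
Lemma tail_le_excess_conjugate lam k :
  (\sum_(r < q | k <= r) part lam r <= excess k (conjugate lam))%N.
Proof.
under eq_bigr => r _ do rewrite -(mdeg_column lam r) mdegE.
rewrite exchange_big /=; apply: leq_sum => i _.
under eq_bigr => r _ do rewrite mnmE; rewrite mnmE.
have [/existsP[r /andP[le_kr lt_ir]]|] :=
    boolP [exists r : 'I_q, (k <= r) && (i < part lam r)]%N; last first.
  rewrite negb_exists => /forallP none; rewrite big1 // => r le_kr.
  by have := none r; rewrite le_kr /= => /negPf ->.
rewrite [X in (_ <= X - _)%N](bigID (fun r : 'I_q => k <= r)%N) /=.
have -> : (\sum_(r' < q | ~~ (k <= r')) (i < part lam r') = k)%N.
  rewrite (eq_bigr (fun=> 1%N)) => [|r'].
    under eq_bigl => r' do rewrite -ltnNge.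
    have le_kq : (k <= q)%N by apply: leq_trans (ltnW (ltn_ord r)).
    by rewrite -(big_ord_widen q (fun=> 1%N) le_kq) sum_nat_const card_ord muln1.
  rewrite -ltnNge => lt_r'k; suff -> : (i < part lam r')%N by [].
  by apply: leq_trans lt_ir (leq_part lam _); exact: leq_trans (ltnW lt_r'k) le_kr.
by rewrite addnK.
Qed.

Lemma mcoeff_conjugate_gt0 lam : 0 < (mesym_prod R (ex lam))@_(conjugate lam).
Proof.
have -> : conjugate lam
    = (\sum_(r < q) [multinom ((i < part lam r)%N : nat) | i < q])%MM.
  apply/mnmP => i; rewrite mnm_sumE mnmE; apply: eq_bigr => r _.
  by rewrite mnmE.
apply: (big_ind2 (fun p m => coeff_nonneg p /\ 0 < p@_m) _ _ _).2.
- split=> [m|]; first by rewrite mcoeff1 ler0n.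
  by rewrite mcoeff1 eqxx ltr01.
- move=> p1 m1 p2 m2 [p1_ge0 pos1] [p2_ge0 pos2].
  by split; [exact: coeff_nonnegM | exact: coeff_posM].
move=> r _; split; first exact: mesym_nonneg.
rewrite mcoeff_mesym mnmE /mechar mdeg_column eqxx.
suff -> : [forall i, [multinom ((i < part lam r)%N : nat) | i < q] i <= 1]%N.
  by rewrite ltr01.
by apply/forallP => i; rewrite mnmE leq_b1.
Qed.

(** The monomials of [dual_poly v] are dominated by the conjugate of [kap]. At the
   conjugate itself only the product indexed by [kap] contributes, with a positive
   coefficient, so [eigenfunction_gt0] reaches the squarefree monomial at the bottom
   of the dominance order. *)
Lemma dual_poly_first_ones_gt0 v kap : v kap = 1 ->
  (forall mu, v mu != 0 -> dominated (ex kap) (ex mu)) ->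
  (forall mu, (ev mu)%:R * v mu + \sum_lam (rc mu lam)%:R * v lam
              = (ev kap)%:R * v mu) ->
  0 < (dual_poly v)@_(first_ones q n).
Proof.
move=> v1 supp_v eq_v.
have supp m : (dual_poly v)@_m != 0 ->
    mdeg m = n /\ dominated m (conjugate kap).
  rewrite mcoeff_dual_poly => /sum_neq0[lam [_ _ /=]].
  rewrite mulf_eq0 negb_or => /andP[/supp_v dom /mesym_prod_support[deg_m le_m]].
  split=> [|k]; first by rewrite deg_m mdeg_exponent.
  apply: leq_trans (le_m k) _; under eq_bigr => i _ do rewrite mnmE.
  apply: leq_trans (tail_antitone k dom) _; exact: tail_le_excess_conjugate.
have conj_gt0 : 0 < (dual_poly v)@_(conjugate kap).
  rewrite mcoeff_dual_poly (bigD1 kap) //= v1 mul1r big1 ?addr0.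
    exact: mcoeff_conjugate_gt0.
  move=> lam ne_lk; apply/eqP; rewrite mulf_eq0; apply: contra_neqT ne_lk.
  rewrite negb_or => /andP[/supp_v dom /mesym_prod_support[_ le_m]].
  apply: (dominated_anti le_nq) => //; apply: dominated_tail => k.
  apply: leq_trans (tail_le_excess_conjugate kap k) _.
  by apply: leq_trans (le_m k) _; apply: leq_sum => i _; rewrite mnmE.
have [deg_conj _] := supp _ (lt0r_neq0 conj_gt0).
apply: (eigenfunction_gt0 _ _ (dual_poly_eigenfunction eq_v) _ conj_gt0).
- by rewrite ltr0n.
- exact/symmetric_invariant/dual_poly_symmetric.
- by move=> m /supp; rewrite deg_conj.
- by rewrite mdeg_first_ones.
move=> [|k]; first by rewrite !excess0 mdeg_first_ones // deg_conj.
rewrite [leqLHS]big1 // => i _; rewrite mnmE.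
by case: (i < n)%N => //; rewrite subSS.
Qed.

End DualPolynomial.

(** * Zonal polynomials *)

Lemma pair_quotients (F : fieldType) (z x1 d1 x2 d2 : F) : z != 0 ->
  z * (x1 / z * d1 + x2 / - z * d2) = x1 * d1 - x2 * d2.
Proof. by move=> nz; rewrite invrN; field. Qed.

Lemma half_double (F : fieldType) (h x : F) : h + h = 1 -> h * (x + x) = x.
Proof. by move=> hh; rewrite mulrDr -mulrDl hh mul1r. Qed.

Section Zonal.
Variables (R : realFieldType) (n q : nat).
Hypothesis le_nq : (n <= q)%N.
Implicit Types lam mu kap : intpartn n.
Local Notation ex := (@exponent n q).
Local Notation rc := (@raise_coeff n q).
Local Notation ev := (@double_eigenvalue n q).

Lemma mcoeff_monomial_sym lam (m : 'X_{1..q}) :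
  (monomial_sym R q lam)@_m = (of_shape lam m)%:R.
Proof.
rewrite /monomial_sym size_parts // -/(ex lam) raddf_sum /=.
set l := image_mem _ _.
have l_mono p : p \in l -> exists s : 'S_q, p = 'X_[[multinom ex lam (s i) | i < q]].
  by move=> /imageP[s _ ->]; exists (s^-1)%g; rewrite msymX.
have X_inj (m1 m2 : 'X_{1..q}) : ('X_[R, m1] == 'X_[m2]) = (m1 == m2).
  apply/eqP/eqP => [/(congr1 (mcoeff m2))|-> //].
  by rewrite !mcoeffX eqxx; case: eqP => // _ /eqP; rewrite eq_sym oner_eq0.
rewrite big_seq (eq_bigr (fun p => (p == 'X_[m])%:R)); last first.
  move=> p; rewrite mem_undup => /l_mono[s ->].
  by rewrite mcoeffX X_inj.
rewrite -big_seq -natr_sum; congr _%:R.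
have -> : (\sum_(p <- undup l) (p == 'X_[m]) = ('X_[m] \in l))%N.
  rewrite -mem_undup -count_uniq_mem ?undup_uniq // -sum1_count [RHS]big_mkcond.
  by apply: eq_bigr => p _ /=; case: eqP.
congr nat_of_bool; apply/idP/existsP => [/l_mono[s /eqP]|[s /eqP ->]].
  by rewrite X_inj => def_m; exists s.
by apply/imageP; exists (s^-1)%g; rewrite // msymX invgK.
Qed.

Lemma of_shape_perm lam (m : 'X_{1..q}) (s : 'S_q) :
  of_shape lam [multinom m (s i) | i < q] = of_shape lam m.
Proof.
apply/existsP/existsP => -[t /eqP def_m].
  exists (s^-1 * t)%g; apply/eqP/mnmP => i; rewrite mnmE permM.
  by have /mnmP/(_ (s^-1%g i)) := def_m; rewrite !mnmE permKV.
by exists (s * t)%g; apply/eqP/mnmP => i; rewrite mnmE def_m !mnmE permM.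
Qed.

Lemma of_shape_exponent lam mu : of_shape lam (ex mu) = (lam == mu).
Proof.
apply/existsP/eqP => [[s /eqP /(exponent_inj le_nq) ->] //|->].
by exists 1%g; apply/eqP/mnmP => i; rewrite mnmE perm1.
Qed.

Variable c : intpartn n -> intpartn n -> R.
Hypothesis zonal_c : is_zonal_coeffs q c.
Local Notation zonal := (zonal_poly q c).

Lemma mcoeff_zonal kap (m : 'X_{1..q}) :
  (zonal kap)@_m = \sum_(lam | lex_le lam kap) c kap lam * (of_shape lam m)%:R.
Proof.
rewrite raddf_sum; apply: eq_bigr => lam _.
by rewrite /= mcoeffZ mcoeff_monomial_sym.
Qed.

Lemma lex_total lam kap : lex_le lam kap = ~~ lex_lt kap lam.
Proof. by rewrite /lex_le /lex_lt leNgt. Qed.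

Lemma mcoeff_zonal_exponent kap lam : (zonal kap)@_(ex lam) = c kap lam.
Proof.
rewrite mcoeff_zonal; have [le_lk|] := boolP (lex_le lam kap).
  rewrite (bigD1 lam) //= of_shape_exponent eqxx mulr1 big1 ?addr0 // => mu /andP[_ ne].
  by rewrite of_shape_exponent (negPf ne) mulr0.
rewrite lex_total negbK => lt_kl; rewrite (zonal_upper zonal_c lt_kl).
apply: big1 => mu le_mk; rewrite of_shape_exponent; case: eqP => [eq_ml|]; last first.
  by rewrite mulr0.
by move: le_mk; rewrite eq_ml lex_total lt_kl.
Qed.

Lemma zonal_symmetric kap : zonal kap \is symmetric.
Proof.
apply/issymP => s; apply/mpolyP => m; rewrite mcoeff_sym !mcoeff_zonal.
by apply: eq_bigr => lam _; rewrite of_shape_perm.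
Qed.

Lemma zonal_support kap (m : 'X_{1..q}) : (zonal kap)@_m != 0 ->
  exists lam, exists s : 'S_q,
    m = [multinom ex lam (s i) | i < q] /\ c kap lam != 0.
Proof.
move=> m_neq0; move: (m_neq0); rewrite {1}mcoeff_zonal => /sum_neq0[lam [_ _ /=]].
rewrite mulf_eq0 negb_or pnatr_eq0 eqb0 negbK => /andP[_ /existsP[s /eqP def_m]].
exists lam, s; split=> //; rewrite -mcoeff_zonal_exponent.
by rewrite -(symmetric_invariant (zonal_symmetric kap) s) -def_m.
Qed.

Lemma natr_double_eigenvalue lam :
  (ev lam)%:R = 2 * (falling_squares (ex lam))%:R + (max_sum (ex lam))%:R :> R.
Proof. by rewrite /double_eigenvalue natrD natrM. Qed.

Lemma eigenvalueE kap :
  (rho kap)%:~R + (q%:R - 1) * n%:R = 2^-1 * (ev kap)%:R :> R.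
Proof.
rewrite -(rho_eigenvalue le_nq) natr_double_eigenvalue mulrDr mulrA.
by rewrite mulVf ?pnatr_eq0 // mul1r.
Qed.

(** Grouping the terms of the operator in pairs replaces the quotients by divided
   differences, which are polynomials. *)
Lemma zonal_eigenfunction kap :
  eigenfunction 2^-1 (2^-1 * (ev kap)%:R) (fun m => (zonal kap)@_m).
Proof.
have sym_f := zonal_symmetric kap; set f := zonal kap in sym_f *.
have [G dG] : exists G : 'I_q -> 'I_q -> {mpoly R[q]},
    forall i j, j != i -> divided_difference i j f (G i j).
  have row i : exists g : 'I_q -> {mpoly R[q]},
      forall j, j != i -> divided_difference i j f (g j).
    apply: (@fin_all_exists _ _ (fun j g => j != i -> divided_difference i j f g)) => j.
    have [->|ne_ji] := eqVneq j i; first by exists 0.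
    by have [g dg] := divided_difference_ex ne_ji sym_f; exists g.
  exact: (@fin_all_exists _ _ (fun i g => forall j, j != i ->
    divided_difference i j f (g j)) row).
apply: (eigenfunction_mcoeff sym_f dG); rewrite -eigenvalueE.
apply/eqP; rewrite -tofrac_eq; apply/eqP; rewrite -/f -(zonal_eigen zonal_c kap).
pose a i j : {fraction {mpoly R[q]}} :=
  tofrac ('X_i ^+ 2) / tofrac ('X_i - 'X_j) * tofrac (f^`M(i)).
pose A := \sum_i \sum_(j | j != i) a i j.
have pairE i j : j != i -> a i j + a j i = tofrac (G i j).
  move=> ne_ji; have nz : tofrac ('X_i - 'X_j : {mpoly R[q]}) != 0.
    rewrite tofrac_eq0 subr_eq0; apply: contraNneq ne_ji.
    move=> /(congr1 (mcoeff U_(i))); rewrite !mcoeffX eqxx eq_mnm1.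
    by case: (j == i) => // /eqP; rewrite oner_eq0.
  have zG : tofrac ('X_i - 'X_j) * tofrac (G i j)
      = tofrac ('X_i ^+ 2) * tofrac (f^`M(i)) - tofrac ('X_j ^+ 2) * tofrac (f^`M(j)).
    rewrite -[LHS]tofracM (dG i j ne_ji) tofracB.
    by congr (_ - _); exact: tofracM.
  apply: (mulfI nz); rewrite zG /a.
  have -> : tofrac ('X_j - 'X_i : {mpoly R[q]}) = - tofrac ('X_i - 'X_j).
    by rewrite -tofracN opprB.
  exact: pair_quotients.
have sumE : A + A = tofrac (\sum_i \sum_(j | j != i) G i j).
  rewrite {2}/A (exchange_big_dep xpredT) //= -big_split rmorph_sum /=.
  apply: eq_bigr => i _; rewrite rmorph_sum /=.
  have -> : \sum_(j | i != j) a j i = \sum_(j | j != i) a j i.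
    by apply: eq_bigl => j; rewrite eq_sym.
  rewrite -big_split; apply: eq_bigr => j ne_ji. 
  by rewrite /= pairE.
have -> : Delta f = tofrac (\sum_i 'X_i ^+ 2 * (f^`M(i))^`M(i)) + A.
  by rewrite /Delta big_split rmorph_sum.
rewrite tofracD -mul_mpolyC tofracM -sumE; congr (_ + _); apply: half_double.
have half : 2^-1 + 2^-1 = 1 :> R by lra.
by rewrite -tofracD -mpolyCD half mpolyC1 tofrac1.
Qed.

Lemma zonal_row kap lam :
  (ev lam)%:R * c kap lam + \sum_mu c kap mu * (rc mu lam)%:R
  = (ev kap)%:R * c kap lam.
Proof.
have := zonal_eigenfunction kap (ex lam).
rewrite (raising_expand le_nq lam (symmetric_invariant (zonal_symmetric kap))).
rewrite mcoeff_zonal_exponent.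
have -> : \sum_mu (zonal kap)@_(ex mu) *+ rc mu lam
    = \sum_mu c kap mu * (rc mu lam)%:R.
  by apply: eq_bigr => mu _; rewrite mcoeff_zonal_exponent mulr_natr.
set S := bigop _ _ _; rewrite !natr_double_eigenvalue; lra.
Qed.

(** A nonzero coefficient away from the diagonal is a combination of coefficients at
   raised partitions, so one of these is nonzero and dominance is inherited from it.
   Where the recursion would divide by zero, the coefficients vanish by definition. *)
Lemma zonal_dominated kap lam : c kap lam != 0 -> dominated (ex lam) (ex kap).
Proof.
have fs_le mu : (falling_squares (ex mu) <= n * n)%N.
  have le_n i : (ex mu i <= n)%N.
    rewrite -[leqRHS](mdeg_exponent le_nq mu) mdegE (bigD1 i) //=.
    exact: leq_addr.
  have -> : (n * n = \sum_i ex mu i * n)%N.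
    by rewrite -big_distrl /= -mdegE mdeg_exponent.
  apply: leq_sum => i _; rewrite leq_mul2l (leq_trans (leq_pred _)) ?orbT //.
have [k] := ubnP (n * n - falling_squares (ex lam)).
elim: k lam => // k IHk lam le_k c_neq0.
have [->|ne_lk] := eqVneq lam kap; first exact: dominated_refl.
have lt_lk : lex_lt lam kap.
  have : lex_le lam kap.
    by rewrite lex_total; apply: contra_neqN c_neq0 => /(zonal_upper zonal_c).
  by rewrite lex_leE (negPf ne_lk).
have lt_rho : rho lam < rho kap.
  by rewrite ltNge; apply: contra_neqN c_neq0 => /(zonal_rho zonal_c lt_lk).
have : \sum_mu c kap mu * (rc mu lam)%:R != 0.
  have -> : \sum_mu c kap mu * (rc mu lam)%:R
      = ((ev kap)%:R - (ev lam)%:R) * c kap lam.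
    by rewrite mulrBl -zonal_row addrAC subrr add0r.
  rewrite mulf_neq0 // subr_eq0; apply: contraTneq lt_rho => eq_ev.
  have := eigenvalueE kap; rewrite eq_ev -eigenvalueE => /addIr /intr_inj ->.
  by rewrite ltxx.
move=> /sum_neq0[mu [_ _ /=]]; rewrite mulf_eq0 negb_or pnatr_eq0.
move=> /andP[c_mu /(raise_coeff_neq0 le_nq)[dom lt_fs]].
apply: dominated_trans dom (IHk mu _ c_mu).
by have := fs_le mu; lia.
Qed.

(** Left and right eigenvectors of the triangular system are orthogonal; equal
   eigenvalues cause no exception, since their supports meet only when the indices
   are comparable. *)
Lemma zonal_dual_orthogonal (v : intpartn n -> R) kap kap' :
  (forall mu, v mu != 0 -> dominated (ex kap) (ex mu)) ->
  (forall mu, (ev mu)%:R * v mu + \sum_lam (rc mu lam)%:R * v lam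
              = (ev kap)%:R * v mu) ->
  kap' != kap -> \sum_lam c kap' lam * v lam = 0.
Proof.
move=> supp_v eq_v ne_kk; have [eq_ev|ne_ev] := eqVneq (ev kap) (ev kap').
  apply: big1 => lam _; apply/eqP; apply: contra_neqT ne_kk.
  rewrite mulf_eq0 negb_or => /andP[/zonal_dominated dom' /supp_v dom].
  apply: esym; apply: (double_eigenvalue_inj le_nq _ eq_ev).
  exact: dominated_trans dom dom'.
have : ((ev kap)%:R - (ev kap')%:R) * (\sum_lam c kap' lam * v lam) = 0.
  rewrite mulrBl !mulr_sumr.
  under eq_bigr => mu _ do rewrite mulrCA -eq_v mulrDr mulr_sumr.
  under [X in _ - X]eq_bigr => lam _ do rewrite mulrA -zonal_row mulrDl mulr_suml.
  rewrite !big_split /= [X in _ + X - _]exchange_big /=.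
  apply/eqP; rewrite subr_eq0; apply/eqP; congr (_ + _).
    by apply: eq_bigr => lam _; rewrite mulrCA mulrA.
  apply: eq_bigr => lam _; apply: eq_bigr => mu _; exact: mulrA.
by move=> /eqP; rewrite mulf_eq0 subr_eq0 eqr_nat (negPf ne_ev) => /eqP.
Qed.

(** Pairing the dual eigenvector with the multinomial coefficients gives the diagonal
   entry, by orthogonality and the normalization of the zonal polynomials; the same
   pairing is a coefficient of the dual polynomial. *)
Lemma zonal_diagonal_gt0 kap : 0 < c kap kap.
Proof.
have [v [v1 supp_v eq_v]] := dual_vector R le_nq kap.
have := dual_poly_first_ones_gt0 le_nq v1 supp_v eq_v.
rewrite mcoeff_dual_poly.
have -> : \sum_lam v lam * (mesym_prod R (ex lam))@_(first_ones q n)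
    = \sum_lam \sum_mu c mu lam * v lam.
  apply: eq_bigr => lam _.
  rewrite mcoeff_first_ones_mesym_prod ?mdeg_exponent // -(zonal_sum zonal_c).
  rewrite raddf_sum mulr_sumr; apply: eq_bigr => mu _ /=.
  by rewrite mcoeff_zonal_exponent mulrC.
rewrite exchange_big (bigD1 kap) //= [X in _ + X]big1 => [|mu]; last first.
  exact: zonal_dual_orthogonal.
rewrite addr0 (bigD1 kap) //= v1 mulr1 big1 ?addr0 // => lam ne_lk.
apply/eqP; apply: contra_neqT ne_lk.
rewrite mulf_eq0 negb_or => /andP[/zonal_dominated dom' /supp_v dom].
exact: (dominated_anti le_nq).
Qed.

Lemma zonal_gt0 kap lam : dominated (ex lam) (ex kap) -> 0 < c kap lam.
Proof.
move=> dom; rewrite -mcoeff_zonal_exponent.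
apply: (eigenfunction_gt0 _ _ (zonal_eigenfunction kap) (mu := ex kap)) => //.
- by rewrite invr_gt0 ltr0n.
- exact/symmetric_invariant/zonal_symmetric.
- move=> m /zonal_support[mu [s [-> /zonal_dominated dom_mu]]].
  split=> [|k]; first by rewrite mdeg_mperm !mdeg_exponent.
  by rewrite excess_perm.
- by rewrite mcoeff_zonal_exponent zonal_diagonal_gt0.
- by rewrite !mdeg_exponent.
Qed.

End Zonal.

Theorem theorem4p2 (R : realFieldType) (n q : nat) (hq : (n <= q)%N)
    (c : intpartn n -> intpartn n -> R) (hc : is_zonal_coeffs q c)
    (kap lam : intpartn n) (hle : lex_le lam kap) :
  c kap lam = 0 <->
  exists p : nat, \sum_(0 <= i < p) ((part kap i)%:Z - (part lam i)%:Z) < 0.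
Proof.
have sumE p : \sum_(0 <= i < p) ((part kap i)%:Z - (part lam i)%:Z)
    = (\sum_(i < p) part kap i)%:Z - (\sum_(i < p) part lam i)%:Z.
  by rewrite big_mkord sumrB !(big_morph Posz PoszD (erefl 0%:Z)).
split=> [c0 | [p]].
  have not_dom : ~ dominated (exponent q lam) (exponent q kap).
    by move=> /(zonal_gt0 hq hc); rewrite c0 ltxx.
  have [/existsP[p lt_p]|none] := boolP
    [exists p : 'I_q.+1, \sum_(i < p) part kap i < \sum_(i < p) part lam i]%N.
    by exists p; rewrite sumE subr_lt0 ltz_nat.
  case: not_dom; apply/(dominatedP hq) => p; have [le_qp|lt_pq] := leqP q p.
    have tail0 (mu : intpartn n) : (\sum_(i < q | p <= i) part mu i = 0)%N.
      by apply: big_pred0 => i; rewrite leqNgt (leq_trans (ltn_ord i)).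
    have := partial_sum_tail hq lam p; have := partial_sum_tail hq kap p.
    by rewrite !tail0 !addn0 => -> ->.
  rewrite leqNgt; apply: contraNN none => lt_p; apply/existsP.
  by exists (Ordinal (leqW lt_pq)).
rewrite sumE subr_lt0 ltz_nat => lt_p; apply/eqP; apply: contraTT lt_p.
by move=> /(zonal_dominated hq hc) /(dominatedP hq)/(_ p); rewrite -leqNgt.
Qed.
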